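(* For every integer $n\ge 0$, \[ [q^n]\left(\frac{E^7(q^7)}{E(q)}+q^2\right)\;\geq\;[q^n]\Bigl(q\,\psi^3(q)\psi^3(q^7)\Bigr). \]
   Context: Here $E(q):=\prod_{n=1}^{\infty}(1-q^n)$ and $\psi(q):=\sum_{n=0}^{\infty}q^{n(n+1)/2}$, regarded as power series in $q$ (convergent for $|q|<1$). For a power series $H(q)$, $[q^n]H(q)$ denotes the coefficient of $q^n$ in $H(q)$. *)

(* Defs.v *)
(* MathComp: formal power series in q with integer coefficients. *)
From mathcomp Require Import all_boot all_order all_algebra.
Set Implicit Arguments.
Unset Strict Implicit.
Unset Printing Implicit Defensive.
Import Order.TTheory GRing.Theory Num.Theory.
Local Open Scope ring_scope.

(* [f n] is the coefficient [q^n] f. *)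
Definition fps := nat -> int.

Definition coef (n : nat) (f : fps) : int := f n.

Definition fps_Xn (k : nat) : fps := fun n => (n == k)%:R.

Definition fps_add (f g : fps) : fps := fun n => f n + g n.

Definition fps_mul (f g : fps) : fps :=
  fun n => \sum_(i < n.+1) f i * g (n - i)%N.

Definition fps_exp (f : fps) (k : nat) : fps := iter k (fps_mul f) (fps_Xn 0).

(* f(q^k), for k > 0. *)
Definition fps_dilate (k : nat) (f : fps) : fps :=
  fun n => if (k %| n)%N then f (n %/ k)%N else 0.

(* The coefficients b_0, ..., b_n of 1/f, from f_0 b_0 = 1 and
   f_0 b_m = - \sum_(i < m) f_(m - i) b_i; meaningful when f_0 is a unit,
   see [fps_mulV]. *)
Fixpoint fps_inv_seq (f : fps) (n : nat) : seq int :=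
  if n is m.+1 then
    let s := fps_inv_seq f m in
    rcons s (- ((f 0%N)^-1 * \sum_(i < m.+1) f (m.+1 - i)%N * s`_i))
  else [:: (f 0%N)^-1].

Definition fps_inv (f : fps) : fps := fun n => (fps_inv_seq f n)`_n.

Definition fps_div (f g : fps) : fps := fps_mul f (fps_inv g).

Lemma size_fps_inv_seq (f : fps) (n : nat) : size (fps_inv_seq f n) = n.+1.
Proof. by elim: n => //= n IHn; rewrite size_rcons IHn. Qed.

Lemma nth_fps_inv_seq (f : fps) (m n : nat) :
  (m <= n)%N -> (fps_inv_seq f n)`_m = fps_inv f m.
Proof.
elim: n => [|n IHn]; first by rewrite leqn0 => /eqP ->.
rewrite leq_eqVlt => /predU1P[-> // | lt_mn].
by rewrite /= nth_rcons size_fps_inv_seq lt_mn IHn.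
Qed.

Lemma fps_mulV (f : fps) :
  f 0%N \is a GRing.unit -> fps_mul f (fps_inv f) =1 fps_Xn 0.
Proof.
move=> f0U [|n]; first by rewrite /fps_mul big_ord1 /= mulrV.
rewrite /fps_mul big_ord_recl subn0 {1}/fps_inv /=.
rewrite nth_rcons size_fps_inv_seq ltnn eqxx mulrN mulVKr //.
rewrite (reindex_inj rev_ord_inj) /=; apply/eqP.
rewrite addrC subr_eq0; apply/eqP/eq_bigr => i _.
rewrite nth_fps_inv_seq; last by rewrite subSS leq_subr.
by rewrite subKn.
Qed.

(* The factors 1 - q^i with i > n do not affect [q^n], see [qEE]. *)
Definition qE : fps :=
  fun n => (\prod_(1 <= i < n.+1) (1 - 'X^i) : {poly int})`_n.

Lemma qEE (n N : nat) : (n <= N)%N ->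
  qE n = (\prod_(1 <= i < N.+1) (1 - 'X^i) : {poly int})`_n.
Proof.
move=> /subnK <-; elim: (N - n)%N => [//|k IHk].
rewrite addSn big_nat_recr //= mulrBr mulr1 coefB coefMXn.
by rewrite ltnS leq_addl subr0 -IHk.
Qed.

Lemma qE0 : qE 0 = 1.
Proof. by rewrite /qE big_geq // coef1. Qed.

(* The terms with k > n do not affect [q^n], see [qpsiE]. *)
Definition qpsi : fps :=
  fun n => \sum_(0 <= k < n.+1) fps_Xn (k * k.+1 %/ 2) n.

Lemma qpsiE (n N : nat) : (n <= N)%N ->
  qpsi n = \sum_(0 <= k < N.+1) fps_Xn (k * k.+1 %/ 2) n.
Proof.
move=> /subnK <-; elim: (N - n)%N => [//|k IHk].
rewrite addSn big_nat_recr //= -IHk /fps_Xn.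
set m := (_ + n).+1; rewrite ltn_eqF ?addr0 //.
apply: (@leq_trans m); first by rewrite ltnS leq_addl.
by rewrite leq_divRL // leq_mul2l orbT.
Qed.

(* Main.v *)
(** Put [N = n + 2], [xi = q psi(q) psi(q^7)], and let [c(N)] be the number of
    [w] in Z^7 with coordinate sum 0, [|w|^2 = 14 N] and [w_i = i mod 7] for
    [-3 <= i <= 3].  Comparing coefficients in a finite Jacobi triple product
    shows [q^n] E(q^7)^7 / E(q) >= c(N) (the generating function of 7-cores),
    and the right-hand side of the theorem is [q^N] xi^3.

    Let [y(N)] count the vectors of sum 0 and norm [14 N] whose residues
    mod 7 form an arithmetic progression.  The 42 nonconstant progressions
    contribute [c(N)] each, and a reflection shows that the 7 constant ones
    contribute at most [14 c(N)] together, so [y(N) <= 56 c(N)].  Conversely,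
    triples of pairs (x, y) weighted by x^2 + 7 y^2, with suitable parity
    conditions, embed into these vectors, which gives
    [y >= theta^3 + 36 theta xi^2 - 16 xi^3].  The quadratic relation between
    the odd and even parts of [xi] and [theta] makes dissection modulo 2 act
    on cubic forms in [theta] and [xi]; three such steps show that the
    coefficients of [theta^3 + 36 theta xi^2 - 72 xi^3] are nonnegative except
    at [N = 4], so [56 [q^N] xi^3 <= y(N)].  The remaining loss at an odd square [m^2] is
    absorbed by writing [m^2] as a nontrivial sum of three squares, by way of
    Lagrange's theorem.  For [N = 4] the extra term q^2 is needed. *)
Require Import Defs.
From Stdlib Require Import ZArith Lia ZifyBool.
From HB Require Import structures.
From mathcomp Require Import all_boot all_order all_algebra.
From mathcomp Require Import boolp.
From mathcomp Require Import ring lra zify ssrZ.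
Set Implicit Arguments.
Unset Strict Implicit.
Unset Printing Implicit Defensive.
Import Order.TTheory GRing.Theory Num.Theory.
Local Open Scope ring_scope.
Delimit Scope nat_scope with N.
Delimit Scope Z_scope with Z.
Arguments Z.mul : simpl never.
Arguments Z.add : simpl never.
Arguments Z.sub : simpl never.
Arguments Z.opp : simpl never.
Arguments Z.modulo : simpl never.
Arguments Z.div : simpl never.
Arguments Z.eqb : simpl never.
Arguments Z.ltb : simpl never.
Arguments Z.leb : simpl never.
Arguments Z.of_nat : simpl never.
Ltac Zify.zify_post_hook ::= elim_bool_cstr;
  zify_ssreflect.SsreflectZifyInstances.divZ_modZ_to_equations;
  Z.to_euclidean_division_equations.

(** * Sums of squares *)

Section NatSquares.
Local Open Scope nat_scope.

(** The arithmetic behind the series is that of O = Z[(1 + sqrt(-7))/2], where 2 = pi * conj pi.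
    [theta] is the sum of q^(2 N(alpha)) over alpha in O, and twice [q^n] xi counts the alpha of
    norm 2n divisible by pi but not by conj pi. Division by pi gives [q^(2n)] xi = [q^n] xi, and
    phi(q) phi(-q) = phi(-q^2)^2 determines the square of the odd part of xi. A single residue class
    of vectors shows no such structure; the union of the 49 progression classes contains a lattice
    that is a module of rank 3 over O, which is why y(N) replaces c(N). There is no room in the
    constants: 56 = 42 + 14, and with -72 = -16 - 56 the odd coefficients of the cubic form vanish
    identically, so that at odd N the bound of 56 xi^3 by the cubic form of y is an equality.
    Negative coefficients thus have to be followed through the dissections. What finally remains is
    a loss of 3 times a coefficient of the odd part of xi, to be paid by xi^3; at index 1, that is N
    = 4, xi^3 has nothing to pay with. *)

Lemma sqr_add_sqr_add1 p : prime p -> odd p ->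
  exists i j, (p %| i ^ 2 + j ^ 2 + 1)%N /\ (i ^ 2 + j ^ 2 + 1 < p ^ 2)%N.
Proof.
move=> p_pr p_odd; have p_gt1 := prime_gt1 p_pr.
have Ep : p = (p./2 + p./2).+1 by rewrite addnn -[LHS]odd_double_half p_odd.
set h := p./2.+1.
(* Pigeonhole: the [h] squares and the [h] residues of - 1 - j^2 are p + 1 values below p, and
   neither family repeats a value. *)
pose f (x : 'I_h + 'I_h) : nat :=
  match x with inl i => i ^ 2 %% p | inr j => p.-1 - j ^ 2 %% p end.
have f_lt x : (f x < p)%N.
  case: x => i /=; first by rewrite ltn_mod; lia.
  by apply: leq_ltn_trans (leq_subr _ _) _; lia.
pose g x := Ordinal (f_lt x).
have sq_inj (i j : nat) : (i < j < h)%N -> i ^ 2 = j ^ 2 %[mod p] -> False.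
  move=> /andP[ij jh] /eqP; rewrite eq_sym eqn_mod_dvd; last by rewrite leq_exp2r // ltnW.
  rewrite subn_sqr Euclid_dvdM // => /orP[] /dvdn_leq; rewrite /h in jh; lia.
have mod_lt i : (i ^ 2 %% p < p)%N by rewrite ltn_mod; lia.
have /injectivePn[x [y xy gxy]] : ~~ injectiveb g.
  apply/negP => /injectiveP/leq_card; rewrite card_sum !card_ord /h; lia.
have {gxy} fxy : f x = f y by case: gxy.
have same (i j : 'I_h) : i ^ 2 %% p = j ^ 2 %% p -> i = j.
  move=> E; apply: val_inj => /=; case: (ltngtP i j) => // lt_ij.
    by case: (@sq_inj i j) => //; rewrite lt_ij ltn_ord.
  by case: (@sq_inj j i) => //; rewrite lt_ij ltn_ord.
have diff (i j : 'I_h) : i ^ 2 %% p = p.-1 - j ^ 2 %% p ->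
  (p %| i ^ 2 + j ^ 2 + 1)%N /\ (i ^ 2 + j ^ 2 + 1 < p ^ 2)%N.
  move=> E; split.
    have Es : i ^ 2 %% p + j ^ 2 %% p + 1 = p by have := mod_lt j; lia.
    apply/dvdnP; exists (i ^ 2 %/ p + j ^ 2 %/ p + 1).
    have := divn_eq (i ^ 2) p; have := divn_eq (j ^ 2) p.
    move: (i ^ 2 %/ p) (j ^ 2 %/ p) (i ^ 2 %% p) (j ^ 2 %% p) Es => a b c d Es -> ->; lia.
  have := ltn_ord i; have := ltn_ord j; rewrite /h; nia.
case: x y xy fxy => [i|i] [j|j] xy /= fxy.
- by move: xy; rewrite (same _ _ fxy) eqxx.
- by exists i, j; apply: diff.
- by exists j, i; apply: diff.
- have E : (i ^ 2 %% p = j ^ 2 %% p)%N by have := mod_lt i; have := mod_lt j; lia.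
  by move: xy; rewrite (same _ _ E) eqxx.
Qed.

End NatSquares.

Section IntSquares.
Local Open Scope Z_scope.

Lemma centered_mod m x : 0 < m -> exists y k, x = y + m * k /\ - m <= 2 * y <= m.
Proof.
move=> m0; have := Z.div_mod (2 * x + m) (2 * m) ltac:(lia).
have := Z.mod_pos_bound (2 * x + m) (2 * m) ltac:(lia).
set q := (_ / _); move=> H1 H2; exists (x - m * q), q; lia.
Qed.

Definition sum4 (a b c d : Z) := a * a + b * b + c * c + d * d.

(* Lagrange's descent: [m p] a sum of four squares with [1 < m < p] gives a smaller [r p]. *)
Lemma four_squares_descent (p m : Z) :
  (forall k l, p = k * l -> 0 < k -> k = 1 \/ k = p) ->
  0 < m < p -> (exists a b c d, sum4 a b c d = m * p) ->
  exists a b c d, sum4 a b c d = p.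
Proof.
move=> p_pr; have [n] : exists n, n = Z.to_nat m by exists (Z.to_nat m).
elim/ltn_ind: n m => n IH m En [m0 mp] [x1 [x2 [x3 [x4 Ex]]]].
have [m1|m1] : m = 1 \/ 1 < m by lia.
  by exists x1, x2, x3, x4; rewrite Ex m1; lia.
have not_dvd l : p = m * l -> False by move=> E; case: (p_pr m l E m0); lia.
have [y1 [k1 [E1 B1]]] := centered_mod x1 m0.
have [y2 [k2 [E2 B2]]] := centered_mod x2 m0.
have [y3 [k3 [E3 B3]]] := centered_mod x3 m0.
have [y4 [k4 [E4 B4]]] := centered_mod x4 m0.
have Sx : sum4 x1 x2 x3 x4 = sum4 y1 y2 y3 y4
  + m * (2 * (k1 * y1 + k2 * y2 + k3 * y3 + k4 * y4) + m * sum4 k1 k2 k3 k4).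
  by rewrite /sum4 E1 E2 E3 E4; ring.
set S := 2 * _ + _ in Sx; pose r := p - S.
have Er : sum4 y1 y2 y3 y4 = m * r by rewrite /r; lia.
have sqb y : - m <= 2 * y <= m -> 4 * (y * y) <= m * m by move=> H; nia.
have r_le : r <= m.
  have : 4 * (m * r) <= 4 * (m * m).
    rewrite -Er /sum4; have := sqb _ B1; have := sqb _ B2; have := sqb _ B3; have := sqb _ B4; lia.
  nia.
have r_ge : 0 <= r by have : 0 <= m * r; [rewrite -Er /sum4; nia | nia].
have [r0|[rm|rlt]] : r = 0 \/ r = m \/ 0 < r < m by lia.
- have : y1 = 0 /\ y2 = 0 /\ y3 = 0 /\ y4 = 0 by rewrite r0 /sum4 in Er; nia.
  move=> [e1 [e2 [e3 e4]]]; case: (not_dvd (sum4 k1 k2 k3 k4)).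
  have : S = p by rewrite /r in r0; lia.
  by rewrite /S e1 e2 e3 e4; lia.
(* If r = m, the four bounds 4 y^2 <= m^2 are equalities, so each 2 y is a multiple of m, and then m
   divides p. *)
- have half y : - m <= 2 * y <= m -> 4 * (y * y) = m * m -> exists e, 2 * y = m * e.
    move=> H E; have : (2 * y - m) * (2 * y + m) = 0 by lia.
    by move=> /Z.mul_eq_0[]; [exists 1 | exists (-1)]; lia.
  have [e1 F1] : exists e, 2 * y1 = m * e.
    apply: half => //; have := sqb _ B1; have := sqb _ B2; have := sqb _ B3; have := sqb _ B4.
    rewrite /sum4 rm in Er; lia.
  have [e2 F2] : exists e, 2 * y2 = m * e.
    apply: half => //; have := sqb _ B1; have := sqb _ B2; have := sqb _ B3; have := sqb _ B4.
    rewrite /sum4 rm in Er; lia.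
  have [e3 F3] : exists e, 2 * y3 = m * e.
    apply: half => //; have := sqb _ B1; have := sqb _ B2; have := sqb _ B3; have := sqb _ B4.
    rewrite /sum4 rm in Er; lia.
  have [e4 F4] : exists e, 2 * y4 = m * e.
    apply: half => //; have := sqb _ B1; have := sqb _ B2; have := sqb _ B3; have := sqb _ B4.
    rewrite /sum4 rm in Er; lia.
  case: (not_dvd (1 + k1 * e1 + k2 * e2 + k3 * e3 + k4 * e4 + sum4 k1 k2 k3 k4)).
  have : p = m + (k1 * (2 * y1) + k2 * (2 * y2) + k3 * (2 * y3) + k4 * (2 * y4)
      + m * sum4 k1 k2 k3 k4) by rewrite /r /S in rm; lia.
  by rewrite F1 F2 F3 F4 => ->; ring.
have rn : (Z.to_nat r < n)%N by lia.
apply: (IH _ rn r erefl); first lia.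
(* Euler's product of the sums for x and y: since x = y + m k, its four entries are m times [w1],
   ..., [w4]. *)
pose w1 := r + (k1 * y1 + k2 * y2 + k3 * y3 + k4 * y4).
pose w2 := k1 * y2 - k2 * y1 + k3 * y4 - k4 * y3.
pose w3 := k1 * y3 - k3 * y1 + k4 * y2 - k2 * y4.
pose w4 := k1 * y4 - k4 * y1 + k2 * y3 - k3 * y2.
exists w1, w2, w3, w4; apply: (Z.mul_reg_l _ _ (m * m)); first nia.
have -> : m * m * (r * p) = (m * p) * (m * r) by ring.
rewrite -Ex -Er.
have -> : m * m * sum4 w1 w2 w3 w4 = sum4 (m * r + m * (k1 * y1 + k2 * y2 + k3 * y3 + k4 * y4))
   (m * w2) (m * w3) (m * w4) by rewrite /sum4 /w1; ring.
by rewrite -Er /sum4 /w2 /w3 /w4 E1 E2 E3 E4; ring.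
Qed.

End IntSquares.

Lemma four_squares_prime p : prime p -> odd p ->
  exists a b c d : Z, sum4 a b c d = Z.of_nat p.
Proof.
move=> p_pr p_odd; have p_gt1 := prime_gt1 p_pr.
have [i [j [/dvdnP[m Em] lt_p2]]] := sqr_add_sqr_add1 p_pr p_odd.
apply: (@four_squares_descent _ (Z.of_nat m)).
- move=> k l E k0; have l0 : (0 <= l)%Z by nia.
  have : (Z.to_nat k %| p)%N by apply/dvdnP; exists (Z.to_nat l); nia.
  move/primeP: p_pr => [_ H] /H; lia.
- nia.
exists (Z.of_nat i), (Z.of_nat j), 1%Z, 0%Z; rewrite /sum4; lia.
Qed.

(** If p = a^2 + b^2 + c^2 + d^2, then p^2 = (a^2 + b^2 - c^2 - d^2)^2 + 4 (ac + bd)^2 + 4 (ad -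
    bc)^2. The first term is odd, hence nonzero; the other two vanish together only if one of the
    pairs (a, b), (c, d) is zero. *)
Lemma three_squares_prime p : prime p -> odd p -> exists A B C : nat,
  [/\ p ^ 2 = A ^ 2 + (2 * B) ^ 2 + (2 * C) ^ 2, 0 < A & 0 < B]%N.
Proof.
move=> p_pr p_odd; have p_gt1 := prime_gt1 p_pr.
have nsq (a : Z) : (a * a <> Z.of_nat p)%Z.
  move=> E; have Ep : p = (Z.abs_nat a * Z.abs_nat a)%N by nia.
  have /primeP[_ H] := p_pr; have /H/orP[] : (Z.abs_nat a %| p)%N by rewrite Ep dvdn_mulr.
    by move=> /eqP a1; move: p_gt1; rewrite Ep a1.
  by move=> /eqP ap; move: p_gt1; rewrite -ap in Ep *; nia.
have [a [b [c [d [E ab cd]]]]] : exists a b c d : Z,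
    [/\ sum4 a b c d = Z.of_nat p, (0 < a * a + b * b)%Z & (0 < c * c + d * d)%Z].
  have [a [b [c [d E]]]] := four_squares_prime p_pr p_odd.
  have := nsq a; have := nsq b; have := nsq c; have := nsq d; rewrite /sum4 in E => na nb nc nd.
  have [ab|ab] : (a = 0 /\ b = 0 \/ 0 < a * a + b * b)%Z by nia.
    (* Regrouped as (c, 0), (d, 0), both pairs are nonzero because p is not a square. *)
    by exists c, 0%Z, d, 0%Z; rewrite /sum4; split; nia.
  have [cd|cd] : (c = 0 /\ d = 0 \/ 0 < c * c + d * d)%Z by nia.
    by exists a, 0%Z, b, 0%Z; rewrite /sum4; split; nia.
  by exists a, b, c, d.
pose A := (a * a + b * b - c * c - d * d)%Z.
pose B := (a * c + b * d)%Z; pose C := (a * d - b * c)%Z.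
have Esq : (Z.of_nat p * Z.of_nat p = A * A + 4 * (B * B) + 4 * (C * C))%Z.
  by rewrite -E /sum4 /A /B /C; ring.
have BC : (B * B + C * C = (a * a + b * b) * (c * c + d * d))%Z by rewrite /B /C; ring.
have A0 : A <> 0%Z.
  move=> A0; have : (Z.of_nat p = A + 2 * (c * c + d * d))%Z by rewrite -E /sum4 /A; ring.
  rewrite A0; move: p_odd; lia.
have BC0 : (B <> 0 \/ C <> 0)%Z by nia.
have absE x : exists2 n : nat, (Z.of_nat n * Z.of_nat n = x * x)%Z & (x <> 0)%Z -> (0 < n)%N.
  by exists (Z.abs_nat x); [nia | lia].
have [u Eu u0] := absE A; have [v Ev v0] := absE B; have [w Ew w0] := absE C.
clear absE; have {}u0 := u0 A0; rewrite -Eu -Ev -Ew in Esq.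
case: BC0 => [/v0|/w0] H; [exists u, v, w | exists u, w, v];
  split=> //; apply: Nat2Z.inj; clear - Esq; lia.
Qed.

(** The decomposition at a prime factor of x is scaled. The last clause serves the case C = 0, where
    B^2 will be cut into two equal halves, each twice a square. *)
Lemma three_squares x : odd x -> (1 < x)%N -> exists A B C : nat,
  [/\ x ^ 2 = A ^ 2 + B ^ 2 + C ^ 2, 0 < A, 0 < B & C = 0 -> ~~ odd B]%N.
Proof.
move=> Ox x1; have p_pr := pdiv_prime x1.
have /dvdnP[k Ek] := pdiv_dvd x; have k0 : (0 < k)%N by case: k Ek => [|//] E; lia.
have Op : odd (pdiv x) by move: Ox; rewrite {1}Ek oddM => /andP[].
have [A [B [C [E A0 B0]]]] := three_squares_prime p_pr Op.
exists (k * A)%N, (k * (2 * B))%N, (k * (2 * C))%N.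
rewrite !muln_gt0 k0 A0 B0 !oddM andbF Ek !expnMn E; split=> //; lia.
Qed.

(** * The ring of power series *)

Record series := Series { cf :> nat -> int }.

Lemma seriesP (f g : series) : f =1 g -> f = g.
Proof. by case: f g => f [g] /= /funext ->. Qed.

HB.instance Definition _ := gen_eqMixin series.
HB.instance Definition _ := gen_choiceMixin series.

Definition strunc (N : nat) (f : series) : {poly int} := \poly_(i < N.+1) f i.

Definition sadd (f g : series) := Series (fun n => f n + g n).
Definition sopp (f : series) := Series (fun n => - f n).
Definition szero := Series (fun=> 0).
Definition sone := Series (fun n => (n == 0%N)%:R).
Definition smul (f g : series) :=
  Series (fun n => \sum_(i < n.+1) f i * g (n - i)%N).

(** Carries the ring laws over from polynomials, since index n sees only the truncations. *)
Lemma smul_trunc N (f g : series) n : (n <= N)%N ->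
  smul f g n = (strunc N f * strunc N g)`_n.
Proof.
move=> le_nN; rewrite coefM; apply: eq_bigr => i _.
have le_iN : (i <= N)%N by apply: leq_trans le_nN; rewrite -ltnS.
by rewrite !coef_poly !ltnS le_iN (leq_trans (leq_subr _ _) le_nN).
Qed.

Lemma smulC : commutative smul.
Proof.
by move=> f g; apply: seriesP => n; rewrite !(@smul_trunc n) // mulrC.
Qed.

Lemma smul_truncl N (f : series) (q : {poly int}) n : (n <= N)%N ->
  (strunc N f * q)`_n = \sum_(i < n.+1) f i * q`_(n - i).
Proof.
move=> le_nN; rewrite coefM; apply: eq_bigr => i _.
by rewrite coef_poly ltnS (leq_trans _ le_nN) // -ltnS.
Qed.

Lemma smulA : associative smul.
Proof.
move=> f g h; apply: seriesP => n.
have H1 u v w : smul u (smul v w) n = (strunc n u * (strunc n v * strunc n w))`_n.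
  rewrite (smul_truncl u _ (leqnn n)) [LHS]/=; apply: eq_bigr => i _.
  by rewrite -(@smul_trunc n v w (n - i)) ?leq_subr.
by rewrite H1 (smulC (smul f g)) H1 mulrA mulrC.
Qed.

Lemma smul1 : left_id sone smul.
Proof.
move=> f; apply: seriesP => n /=; rewrite big_ord_recl /= mul1r subn0.
by rewrite big1 ?addr0 // => i _; rewrite /= mul0r.
Qed.

Lemma smulDl : left_distributive smul sadd.
Proof.
move=> f g h; apply: seriesP => n /=; rewrite -big_split /=.
by apply: eq_bigr => i _; rewrite mulrDl.
Qed.

Lemma saddA : associative sadd.
Proof. by move=> f g h; apply: seriesP => n /=; rewrite addrA. Qed.
Lemma saddC : commutative sadd.
Proof. by move=> f g; apply: seriesP => n /=; rewrite addrC. Qed.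
Lemma sadd0 : left_id szero sadd.
Proof. by move=> f; apply: seriesP => n /=; rewrite add0r. Qed.
Lemma saddN : left_inverse szero sopp sadd.
Proof. by move=> f; apply: seriesP => n /=; rewrite addNr. Qed.

HB.instance Definition _ :=
  GRing.isZmodule.Build series saddA saddC sadd0 saddN.

Lemma sone_neq0 : sone != 0 :> series.
Proof. by apply/eqP => /(congr1 (fun f : series => f 0%N)). Qed.

HB.instance Definition _ := GRing.Zmodule_isComNzRing.Build series
  smulA smulC smul1 smulDl sone_neq0.

Lemma cfD (f g : series) n : (f + g) n = f n + g n. Proof. by []. Qed.
Lemma cfN (f : series) n : (- f) n = - f n. Proof. by []. Qed.
Lemma cf0 n : (0 : series) n = 0. Proof. by []. Qed.
Lemma cf1 n : (1 : series) n = (n == 0%N)%:R. Proof. by []. Qed.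
Lemma cfM (f g : series) n :
  (f * g) n = \sum_(i < n.+1) f i * g (n - i)%N.
Proof. by []. Qed.
Lemma cfMn (f : series) k n : (f *+ k) n = f n *+ k.
Proof. by elim: k => // k IH; rewrite !mulrS cfD IH. Qed.
(** Substitution of q^(k+1) for q, with the index shifted to keep the exponent positive: [dil 1] is
    q -> q^2, [dil 3] is q -> q^4, [dil 6] is q -> q^7 and [dil 7] is q -> q^8. *)
Definition dil (k : nat) (f : series) : series :=
  Series (fun n => if (k.+1 %| n)%N then f (n %/ k.+1)%N else 0).

Lemma dilE k f n : dil k f (k.+1 * n)%N = f n.
Proof. by rewrite /= dvdn_mulr // mulKn. Qed.
Lemma dil_ndvd k (f : series) n : ~~ (k.+1 %| n)%N -> dil k f n = 0.
Proof. by move=> /negbTE /= ->. Qed.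

Lemma dilD k : {morph dil k : f g / f + g}.
Proof. by move=> f g; apply: seriesP => n /=; case: ifP. Qed.
Lemma dilN k : {morph dil k : f / - f}.
Proof. by move=> f; apply: seriesP => n /=; case: ifP. Qed.
Lemma dilB k : zmod_morphism (dil k).
Proof. by move=> f g; rewrite dilD dilN. Qed.
Lemma dil1 k : dil k 1 = 1.
Proof.
apply: seriesP => n; have [/dvdnP[m ->]|Hn] := boolP (k.+1 %| n)%N.
  by rewrite mulnC dilE !cf1 muln_eq0.
by rewrite dil_ndvd // cf1; case: n Hn.
Qed.
Lemma sum_multiples k (F : nat -> int) m :
  (forall i, ~~ (k.+1 %| i)%N -> F i = 0) ->
  \sum_(i < (k.+1 * m).+1) F i = \sum_(j < m.+1) F (k.+1 * j)%N.
Proof.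
move=> F0; rewrite -(big_mkord xpredT F) -(big_mkord xpredT (fun j => F (k.+1 * j)%N)).
elim: m => [|m IH]; first by rewrite muln0 !big_nat1 muln0.
rewrite [RHS]big_nat_recr //= -IH (big_cat_nat (n := (k.+1 * m).+1)) //=; last first.
  by rewrite ltnS leq_mul2l leqnSn orbT.
congr (_ + _); rewrite mulnS addSn big_nat_recr /= ?ltnS ?leq_addl //.
rewrite big_nat_cond big1 ?add0r ?addSn // => i /andP[/andP[lo hi] _]; apply: F0.
apply/negP => /dvdnP[j Ej].
have : (k.+1 * m < k.+1 * j < k.+1 * m.+1)%N.
  by rewrite (mulnC _ j) -Ej lo mulnS addSn.
by rewrite !ltn_pmul2l // => /andP[lt_mj]; rewrite ltnS leqNgt lt_mj.
Qed.

Lemma dilM k : {morph dil k : f g / f * g}.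
Proof.
move=> f g; apply: seriesP => n; have [/dvdnP[m ->]|Hn] := boolP (k.+1 %| n)%N.
  rewrite mulnC dilE !cfM (sum_multiples (F := fun i => dil k f i * dil k g (k.+1 * m - i)%N)).
    by apply: eq_bigr => i _; rewrite -mulnBr !dilE.
  by move=> i Hi; rewrite dil_ndvd // mul0r.
rewrite [LHS]dil_ndvd // cfM big1 // => i _.
have [Hi|/dil_ndvd ->] := boolP (k.+1 %| i)%N; last by rewrite mul0r.
rewrite [X in _ * X]dil_ndvd ?mulr0 //.
by rewrite dvdn_subl // leq_ord.
Qed.

HB.instance Definition _ k := GRing.isZmodMorphism.Build series series (dil k) (dilB k).
HB.instance Definition _ k := GRing.isMonoidMorphism.Build series series (dil k)
  (dil1 k, dilM k).

Lemma dil_comp j k f : dil j (dil k f) = dil (j.+1 * k.+1).-1 f.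
Proof.
apply: seriesP => n.
have E : (j.+1 * k.+1).-1.+1 = (j.+1 * k.+1)%N by [].
have [/dvdnP[m ->]|Hn] := boolP (j.+1 %| n)%N; last first.
  rewrite !dil_ndvd // E; apply: contra Hn; exact: dvdn_trans (dvdn_mulr _ _).
rewrite mulnC dilE; have [/dvdnP[l ->]|Hm] := boolP (k.+1 %| m)%N.
  by rewrite (mulnC l) dilE mulnA -[in RHS]E dilE.
by rewrite !dil_ndvd // E dvdn_pmul2l.
Qed.

Lemma dilMn k f n : dil k (f *+ n) = dil k f *+ n.
Proof. exact: rmorphMn. Qed.
Lemma dilX k f n : dil k (f ^+ n) = dil k f ^+ n.
Proof. exact: rmorphXn. Qed.

Definition nonneg (f : series) := forall n, 0 <= f n.

Lemma nonnegD f g : nonneg f -> nonneg g -> nonneg (f + g).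
Proof. by move=> Hf Hg n; rewrite cfD addr_ge0. Qed.
Lemma nonnegM f g : nonneg f -> nonneg g -> nonneg (f * g).
Proof. by move=> Hf Hg n; rewrite cfM sumr_ge0 // => i _; rewrite mulr_ge0. Qed.
Lemma nonneg1 : nonneg 1. Proof. by move=> n; rewrite cf1 ler0n. Qed.
Lemma nonnegX f k : nonneg f -> nonneg (f ^+ k).
Proof.
by move=> Hf; elim: k => [|k IH]; [exact: nonneg1 | rewrite exprS; apply: nonnegM].
Qed.
Lemma nonneg_dil k f : nonneg f -> nonneg (dil k f).
Proof. by move=> Hf n /=; case: ifP. Qed.

Lemma cfM_term_le f g i j : nonneg f -> nonneg g -> f i * g j <= (f * g) (i + j)%N.
Proof.
move=> Hf Hg; rewrite cfM.
have Hi : (i < (i + j).+1)%N by rewrite ltnS leq_addr.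
rewrite (bigD1 (Ordinal Hi)) //= addKn lerDl sumr_ge0 // => k _.
by rewrite mulr_ge0.
Qed.

Lemma cfM_term_ge1 f g i j : nonneg f -> nonneg g ->
  1 <= f i -> 1 <= g j -> 1 <= (f * g) (i + j)%N.
Proof.
move=> Hf Hg fi gj; apply: le_trans (cfM_term_le i j Hf Hg).
by rewrite -[1]mulr1 ler_pM.
Qed.

Definition evens (f : series) := forall n, odd n -> f n = 0.
Definition odds (f : series) := forall n, ~~ odd n -> f n = 0.

Lemma evensD f g : evens f -> evens g -> evens (f + g).
Proof. by move=> Hf Hg n Hn; rewrite cfD Hf ?Hg. Qed.
Lemma evensM f g : evens f -> evens g -> evens (f * g).
Proof.
move=> Hf Hg n Hn; rewrite cfM big1 // => i _.
have [/Hf->|Hi] := boolP (odd i); first by rewrite mul0r.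
by rewrite Hg ?mulr0 // oddB ?leq_ord // Hn (negbTE Hi).
Qed.
Lemma oddsM f g : odds f -> odds g -> evens (f * g).
Proof.
move=> Hf Hg n Hn; rewrite cfM big1 // => i _.
have [Hi|/Hf->] := boolP (odd i); last by rewrite mul0r.
by rewrite (Hg (n - i)%N) ?mulr0 // oddB ?leq_ord // Hn Hi.
Qed.
Lemma odds_evensM f g : odds f -> evens g -> odds (f * g).
Proof.
move=> Hf Hg n Hn; rewrite cfM big1 // => i _.
have [Hi|/Hf->] := boolP (odd i); last by rewrite mul0r.
by rewrite (Hg (n - i)%N) ?mulr0 // oddB ?leq_ord // (negbTE Hn) Hi.
Qed.
Lemma evens_dil f : evens (dil 1 f).
Proof. by move=> n Hn; rewrite dil_ndvd // dvdn2 Hn. Qed.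
Lemma evensMn f k : evens f -> evens (f *+ k).
Proof. by move=> Hf n Hn; rewrite cfMn Hf ?mul0rn. Qed.
Lemma oddsD f g : odds f -> odds g -> odds (f + g).
Proof. by move=> Hf Hg n Hn; rewrite cfD Hf ?Hg. Qed.
Lemma odds_dil k f : odds f -> ~~ odd k -> odds (dil k f).
Proof.
move=> Hf Hk n Hn /=; case: ifP => // /dvdnP[m Em]; rewrite Em mulnK // Hf //.
by move: Hn; rewrite Em oddM /= Hk andbT.
Qed.

(** * Weighted counting *)

(** Each weight has finitely many elements, listed without repetition. A coefficient of a theta
    series is then a count in a list, and an inequality between coefficients is an injection between
    two fibres. *)
Record gset := GSet {
  gT : eqType;
  gw : gT -> nat;
  gfib : nat -> seq gT;
  gfib_uniq : forall n, uniq (gfib n);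
  mem_gfib : forall n z, (z \in gfib n) = (gw z == n)
}.

Definition gcount (G : gset) (P : pred (gT G)) (n : nat) : nat :=
  count P (gfib G n).

Definition gs (G : gset) (P : pred (gT G)) : series :=
  Series (fun n => (gcount P n)%:Z).

Lemma gsE (G : gset) (P : pred (gT G)) n : gs P n = (gcount P n)%:Z.
Proof. by []. Qed.

Lemma nonneg_gs (G : gset) (P : pred (gT G)) : nonneg (gs P).
Proof. by []. Qed.

Lemma gcount_le (G H : gset) (P : pred (gT G)) (Q : pred (gT H))
    (f : gT G -> gT H) n m :
  (forall z, P z -> gw z = n -> Q (f z) /\ gw (f z) = m) ->
  (forall z z', P z -> P z' -> gw z = n -> gw z' = n -> f z = f z' -> z = z') ->
  (gcount P n <= gcount Q m)%N.
Proof.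
move=> Hf finj; rewrite /gcount -!size_filter -(size_map f).
apply: uniq_leq_size.
  rewrite map_inj_in_uniq ?filter_uniq ?gfib_uniq // => z z'.
  rewrite !mem_filter !mem_gfib => /andP[Pz /eqP wz] /andP[Pz' /eqP wz'].
  exact: finj.
move=> _ /mapP[z + ->]; rewrite !mem_filter !mem_gfib => /andP[Pz /eqP wz].
by have [-> ->] := Hf _ Pz wz; rewrite eqxx.
Qed.

Lemma gcount_bij (G H : gset) (P : pred (gT G)) (Q : pred (gT H))
    (f : gT G -> gT H) (g : gT H -> gT G) n m :
  (forall z, P z -> gw z = n -> [/\ Q (f z), gw (f z) = m & g (f z) = z]) ->
  (forall z, Q z -> gw z = m -> [/\ P (g z), gw (g z) = n & f (g z) = z]) ->
  gcount P n = gcount Q m.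
Proof.
move=> Hf Hg; apply/eqP; rewrite eqn_leq; apply/andP; split.
  apply: (gcount_le (f := f)) => [z Pz /(Hf _ Pz)[] // | z z' Pz Pz' wz wz' E].
  by have [_ _ <-] := Hf _ Pz wz; have [_ _ <-] := Hf _ Pz' wz'; rewrite E.
apply: (gcount_le (f := g)) => [z Pz /(Hg _ Pz)[] // | z z' Pz Pz' wz wz' E].
by have [_ _ <-] := Hg _ Pz wz; have [_ _ <-] := Hg _ Pz' wz'; rewrite E.
Qed.

Lemma eq_gcount (G : gset) (P Q : pred (gT G)) n :
  (forall z, gw z = n -> P z = Q z) -> gcount P n = gcount Q n.
Proof.
by move=> E; apply: eq_in_count => z; rewrite mem_gfib => /eqP; apply: E.
Qed.

Lemma gcount_sub (G : gset) (P Q : pred (gT G)) n :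
  (forall z, gw z = n -> P z -> Q z) -> (gcount P n <= gcount Q n)%N.
Proof.
move=> E; apply: (gcount_le (f := id)) => // z Pz wz; split=> //; exact: E.
Qed.

Lemma gcount0 (G : gset) (P : pred (gT G)) n :
  (forall z, gw z = n -> ~~ P z) -> gcount P n = 0%N.
Proof.
move=> E; rewrite (@eq_gcount _ _ pred0) ?/gcount ?count_pred0 // => z wz.
exact: negbTE (E _ wz).
Qed.

Lemma gcount_gt0 (G : gset) (P : pred (gT G)) z :
  P z -> (0 < gcount P (gw z))%N.
Proof. by move=> Pz; rewrite -has_count; apply/hasP; exists z; rewrite // mem_gfib. Qed.

Lemma gcount_predID (G : gset) (P Q : pred (gT G)) n :
  gcount P n = (gcount [pred z | P z && Q z] n + gcount [pred z | P z && ~~ Q z] n)%N.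
Proof.
rewrite /gcount; elim: (gfib G n) => //= z s ->.
by case: (P z); case: (Q z) => /=; rewrite ?addnS ?addSn.
Qed.

Lemma gcount_partition (G : gset) (P : pred (gT G)) (k : nat) (f : gT G -> nat) n :
  (forall z, P z -> f z < k)%N ->
  gcount P n = (\sum_(i < k) gcount [pred z | P z && (f z == i)] n)%N.
Proof.
move=> Hf; rewrite /gcount; elim: (gfib G n) => [|z s IH] /=.
  by rewrite big1.
rewrite big_split /= -IH; congr (_ + _)%N.
case: (boolP (P z)) => [Pz|_] /=; last by rewrite big1.
rewrite (bigD1 (Ordinal (Hf z Pz))) //= eqxx big1 // => i /eqP Hi.
by case: eqP => // E; case: Hi; apply: val_inj.
Qed.

Fixpoint gball (G : gset) (n : nat) : seq (gT G) :=
  if n is m.+1 then gball G m ++ gfib G n else gfib G 0.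

Lemma mem_gball G n z : (z \in gball G n) = (gw z <= n)%N.
Proof.
elim: n => [|n IH] /=; first by rewrite mem_gfib leqn0.
by rewrite mem_cat IH mem_gfib orbC -leq_eqVlt.
Qed.

Lemma gball_uniq G n : uniq (gball G n).
Proof.
elim: n => [|n IH]; first exact: gfib_uniq.
rewrite [gball _ _]/(gball G n ++ gfib G n.+1) cat_uniq IH gfib_uniq andbT /=.
apply/hasPn => z; rewrite mem_gfib mem_gball => /eqP ->; by rewrite ltnn.
Qed.

Lemma big_gball G (F : gT G -> nat) n :
  (\sum_(z <- gball G n) F z = \sum_(i < n.+1) \sum_(z <- gfib G i) F z)%N.
Proof.
elim: n => [|n IH]; first by rewrite big_ord1.
by rewrite [in RHS]big_ord_recr /= big_cat IH.
Qed.

Section Prod.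
Variables G H : gset.

Definition gprod_fib n :=
  [seq (x, y) | x <- gball G n, y <- gfib H (n - gw x)].

Lemma gprod_fib_uniq n : uniq (gprod_fib n).
Proof.
apply: allpairs_uniq_dep; first exact: gball_uniq.
  by move=> x _; apply: gfib_uniq.
by case=> [x y] [x' y'] _ _ /= [<- <-].
Qed.

Lemma mem_gprod_fib n z : (z \in gprod_fib n) = (gw z.1 + gw z.2 == n)%N.
Proof.
case: z => x y /=; apply/allpairsPdep/eqP => [[x' [y' []]]|E].
  rewrite mem_gball mem_gfib => Hx /eqP Hy [-> ->].
  by rewrite Hy subnKC.
by exists x, y; rewrite mem_gball mem_gfib -E leq_addr addKn eqxx.
Qed.

Definition gprod := GSet gprod_fib_uniq mem_gprod_fib.

Lemma gs_prod (P : pred (gT G)) (Q : pred (gT H)) :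
  gs (G := gprod) [pred z | P z.1 && Q z.2] = gs P * gs Q.
Proof.
apply: seriesP => n; rewrite cfM gsE /gcount /gfib /=.
rewrite -sum1_count big_mkcond /= big_allpairs_dep /= big_gball.
rewrite (big_morph Posz PoszD (erefl _)); apply: eq_bigr => i _.
rewrite -PoszM; congr Posz.
rewrite big_seq (eq_bigr (fun x => (if P x then 1 else 0) * gcount Q (n - i))%N); last first.
  move=> x; rewrite mem_gfib => /eqP ->; rewrite /gcount -sum1_count.
  case: (P x) => /=; last by rewrite mul0n big1.
  by rewrite mul1n [RHS]big_mkcond.
by rewrite -big_seq -big_distrl /= -big_mkcond sum1_count.
Qed.
End Prod.

Section Scale.
Variables (k : nat) (G : gset).

Definition gscale_fib n := if (k.+1 %| n)%N then gfib G (n %/ k.+1) else [::].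
Definition gscale_w (z : gT G) := (k.+1 * gw z)%N.

Lemma gscale_fib_uniq n : uniq (gscale_fib n).
Proof. by rewrite /gscale_fib; case: ifP => // _; apply: gfib_uniq. Qed.

Lemma mem_gscale_fib n z : (z \in gscale_fib n) = (gscale_w z == n).
Proof.
rewrite /gscale_fib /gscale_w; case: ifP => [/dvdnP[m ->]|Hn].
  by rewrite mulnK // mem_gfib mulnC eqn_pmul2r.
by rewrite in_nil; apply/esym/eqP => E; rewrite -E dvdn_mulr in Hn.
Qed.

Definition gscale := GSet gscale_fib_uniq mem_gscale_fib.

Lemma gs_scale (P : pred (gT G)) : gs (G := gscale) P = dil k (gs P).
Proof.
by apply: seriesP => n; rewrite gsE /gcount /= /gscale_fib; case: ifP.
Qed.
End Scale.

Definition zrange (n : nat) : seq Z :=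
  [seq (Z.of_nat i - Z.of_nat n)%Z | i <- iota 0 (n + n).+1].

Lemma zrange_uniq n : uniq (zrange n).
Proof. rewrite map_inj_uniq ?iota_uniq // => i j; lia. Qed.

Lemma mem_zrange n z : (- Z.of_nat n <= z <= Z.of_nat n)%Z -> z \in zrange n.
Proof.
move=> Hz; apply/mapP; exists (Z.to_nat (z + Z.of_nat n)); last lia.
rewrite mem_iota; lia.
Qed.

Section Base.
Variables (w : Z -> nat).
Hypothesis Hw : forall z, (- Z.of_nat (w z) <= z <= Z.of_nat (w z))%Z.

Definition zfib n := [seq z <- zrange n | w z == n].
Lemma zfib_uniq n : uniq (zfib n).
Proof. by rewrite filter_uniq ?zrange_uniq. Qed.
Lemma mem_zfib n z : (z \in zfib n) = (w z == n).
Proof.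
rewrite mem_filter; case: eqP => //= <-; exact: mem_zrange.
Qed.
Definition gbase := GSet zfib_uniq mem_zfib.
End Base.

Definition wsq (z : Z) : nat := Z.to_nat (z * z).
Lemma wsq_bound z : (- Z.of_nat (wsq z) <= z <= Z.of_nat (wsq z))%Z.
Proof. rewrite /wsq; nia. Qed.
Lemma wsqE z : Z.of_nat (wsq z) = (z * z)%Z.
Proof. rewrite /wsq; nia. Qed.

Definition gsq : gset := gbase wsq_bound.

(** Since 8 z (2z + 1) + 1 = (4z + 1)^2, every triangular number is the weight of exactly one
    integer z. *)
Definition wtri (z : Z) : nat := Z.to_nat (z * (2 * z + 1)).
Lemma wtri_bound z : (- Z.of_nat (wtri z) <= z <= Z.of_nat (wtri z))%Z.
Proof. rewrite /wtri; nia. Qed.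
Lemma wtriE z : Z.of_nat (wtri z) = (z * (2 * z + 1))%Z.
Proof. rewrite /wtri; nia. Qed.

Definition gtri : gset := gbase wtri_bound.

(** * Theta series of x^2 + 7y^2 *)

Definition sX : series := Series (fun n => (n == 1%N)%:R).

Lemma sXM_S f n : (sX * f) n.+1 = f n.
Proof.
rewrite cfM 2!big_ord_recl /= mul0r mul1r add0r subSS subn0 big1 ?addr0 // => i _.
by rewrite mul0r.
Qed.
Lemma sXM_0 f : (sX * f) 0%N = 0.
Proof. by rewrite cfM big_ord1 mul0r. Qed.

Definition phi : series := gs (G := gsq) predT.
Definition psi : series := gs (G := gtri) predT.
Definition psi7 : series := sX * (psi * dil 6 psi).

Definition G2 : gset := gprod gsq (gscale 6 gsq).
Definition Phi : series := phi * dil 6 phi.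

Lemma G2w (z : Z * Z) : Z.of_nat (gw (g := G2) z) = (z.1 * z.1 + 7 * (z.2 * z.2))%Z.
Proof. rewrite /= /gscale_w /=; have := wsqE z.1; have := wsqE z.2; lia. Qed.

Lemma gs_G2 (P Q : pred Z) :
  gs (G := G2) [pred z | P z.1 && Q z.2] = gs (G := gsq) P * dil 6 (gs (G := gsq) Q).
Proof. by rewrite (gs_prod (G := gsq) (H := gscale 6 gsq)) gs_scale. Qed.

(** Read (x, y) as alpha = (x + y sqrt(-7))/2. An odd x means that 2 does not divide alpha, and the
    congruence modulo 4 tells which of pi = (1 + sqrt(-7))/2 ([isP]) and its conjugate ([isQ])
    divides it. *)
Definition isP (z : Z * Z) := ((z.1 mod 2 =? 1) && ((z.1 - z.2) mod 4 =? 0))%Z.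
Definition isQ (z : Z * Z) := ((z.1 mod 2 =? 1) && ((z.1 + z.2) mod 4 =? 0))%Z.
Definition isO (z : Z * Z) :=
  [&& z.1 mod 2 =? 0, z.2 mod 2 =? 0 & (z.1 + z.2) mod 4 =? 2]%Z.
Definition isZ (z : Z * Z) := 
  [&& z.1 mod 2 =? 0, z.2 mod 2 =? 0 & (z.1 + z.2) mod 4 =? 0]%Z.

Definition Gtri : gset := gprod gtri (gscale 6 gtri).

Lemma p_count m :
  (gcount (G := Gtri) predT m)%:Z = psi7 m.+1.
Proof.
rewrite /psi7 sXM_S -gs_scale -(gs_prod (G := gtri) (H := gscale 6 gtri)).
by [].
Qed.

(** Up to the common sign s, x = 4j + 1 and y = 4k + 1, and x^2 + 7 y^2 = 8 (j (2j + 1) + 7 k (2k +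
    1) + 1). *)
Lemma isP_half (s r : Z) m : (s = 1 /\ r = 1 \/ s = -1 /\ r = 3)%Z ->
  gcount (G := G2) [pred z | isP z && (z.1 mod 4 =? r)%Z] (8 * m.+1) =
  gcount (G := Gtri) predT m.
Proof.
move=> Hs.
apply: (gcount_bij (G := G2) (H := Gtri)
  (f := fun z : Z * Z => ((s * z.1 / 4, s * z.2 / 4)%Z : Z * Z))
  (g := fun z : Z * Z => ((s * (4 * z.1 + 1), s * (4 * z.2 + 1))%Z : Z * Z))).
- case=> x y; change Z in x, y; rewrite /isP /= => Hx Hw.
  have [j [k [Ej Ek]]] : exists j k, (x = s * (4 * j + 1) /\ y = s * (4 * k + 1))%Z.
    by exists (s * x / 4)%Z, (s * y / 4)%Z; case: Hs => -[Es Er]; subst s r; lia.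
  have Ej' : (s * x / 4 = j)%Z by case: Hs => -[Es Er]; subst s r; lia.
  have Ek' : (s * y / 4 = k)%Z by case: Hs => -[Es Er]; subst s r; lia.
  rewrite Ej' Ek' -Ej -Ek; split=> //.
  have := wsqE x; have := wsqE y; have := wtriE j; have := wtriE k.
  move: Hw; rewrite /gscale_w /=.
  by case: Hs => -[Es Er]; subst s r; subst x y; lia.
- case=> j k; change Z in j, k; move=> /= _ Hw.
  have := wsqE (s * (4 * j + 1)); have := wsqE (s * (4 * k + 1)).
  have := wtriE j; have := wtriE k; move: Hw; rewrite /gscale_w /isP /=.
  case: Hs => -[-> ->] Hw H1 H2 H3 H4; (split; [lia | lia | congr pair; lia]).
Qed.

Lemma gs_isP : gs (G := G2) isP = dil 7 (psi7 *+ 2).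
Proof.
apply: seriesP => n; have [/dvdnP[m ->]|Hn] := boolP (8 %| n)%N; last first.
  rewrite dil_ndvd // gsE gcount0 // => -[x y]; change Z in x, y; move=> Hw; apply/negP; rewrite /isP /= => Hxy.
  have := G2w (x, y); rewrite Hw /= => E; case/negP: Hn.
  have [j [k [Ej Ek]]] : exists j k, (x = 2 * j + 1 /\ y = x + 4 * k)%Z.
    exists (x / 2)%Z, ((y - x) / 4)%Z; lia.
  have : (exists l, Z.of_nat n = 8 * l)%Z.
    by exists (x * x + 7 * (x * k + 2 * k * k))%Z; rewrite E Ek; ring.
  by case=> l El; apply/dvdnP; exists (Z.to_nat l); lia.
rewrite mulnC dilE cfMn; case: m => [|m].
  rewrite muln0 gsE gcount0 /psi7 ?sXM_0 ?mul0rn // => -[x y]; change Z in x, y; move=> Hw; apply/negP; rewrite /isP /= => Hxy.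
  have := G2w (x, y); rewrite Hw /= => E; nia.
rewrite gsE (gcount_predID (G := G2) _ (fun z : Z * Z => z.1 mod 4 =? 1)%Z) PoszD mulr2n -p_count.
congr (Posz _ + Posz _); first by apply: (@isP_half 1); left.
rewrite -(@isP_half (-1) 3); last by right.
apply: eq_gcount => -[x y]; change Z in x, y; move=> _; rewrite /isP /=; lia.
Qed.

Lemma gs_isQ : gs (G := G2) isQ = dil 7 (psi7 *+ 2).
Proof.
rewrite -gs_isP; apply: seriesP => n; rewrite !gsE; congr Posz.
have wN x y : gw (g := G2) (x, (- y)%Z) = gw (g := G2) (x, y).
  apply: Nat2Z.inj; rewrite !G2w /=; lia.
apply: (gcount_bij (G := G2) (H := G2) (f := fun z : Z * Z => ((z.1, - z.2)%Z : Z * Z))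
   (g := fun z : Z * Z => ((z.1, - z.2)%Z : Z * Z))).
all: by case=> x y; change Z in x, y; rewrite /isP /isQ [LHS in LHS = _ -> _]/= => Hz Hw;
  split; [move: Hz => /=; lia | rewrite wN | rewrite /= Z.opp_involutive].
Qed.

(** Division of x + y sqrt(-7) by 1 + sqrt(-7), an element of norm 8. For odd n the quotient has
    integer coordinates. *)
Lemma isP_odd n : odd n -> gcount (G := G2) isP (8 * n) = gcount (G := G2) predT n.
Proof.
move=> On.
apply: (gcount_bij (G := G2) (H := G2) (f := fun z : Z * Z => (((z.1 + 7 * z.2) / 8, (z.2 - z.1) / 8)%Z : Z * Z))
  (g := fun z : Z * Z => ((z.1 - 7 * z.2, z.1 + z.2)%Z : Z * Z))).
- case=> x y; change Z in x, y; move=> Hz Hw; have := G2w (x, y); rewrite Hw /= => E; move: Hz; rewrite /isP /= => Hz.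
  have [j Ej] : exists j, (x = 2 * j + 1)%Z by exists (x / 2)%Z; lia.
  have [k Ek] : exists k, (y = x + 4 * k)%Z by exists ((y - x) / 4)%Z; lia.
  have [l El] : exists l, (k = 2 * l)%Z.
    exists (k / 2)%Z; have : (k mod 2 = 1 -> False)%Z; last lia.
    move=> k1; have [l El] : exists l, (k = 2 * l + 1)%Z by exists (k / 2)%Z; lia.
    rewrite Ek El Ej in E; lia.
  have -> : ((x + 7 * y) / 8 = x + 7 * l)%Z by lia.
  have -> : ((y - x) / 8 = l)%Z by lia.
  split=> //; last by congr pair; lia.
  apply: Nat2Z.inj; rewrite (G2w (_, _)) /=; rewrite Ek El in E; lia.
- case=> x y; change Z in x, y; move=> _ Hw; have := G2w (x, y); rewrite Hw /= => E.
  have [m Em] : exists m, (x + y = 2 * m + 1)%Z.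
    exists ((x + y) / 2)%Z; have : ((x + y) mod 2 = 0 -> False)%Z; last lia.
    move=> H0; have [m Em] : exists m, (x = 2 * m - y)%Z by exists ((x + y) / 2)%Z; lia.
    rewrite Em in E; lia.
  split; first by rewrite /isP /=; lia.
    apply: Nat2Z.inj; rewrite (G2w (_, _)) /=; lia.
  by congr pair; lia.
Qed.

(** Division by pi: alpha has norm 4 n and is prime to the conjugate of pi, so pi^2 divides it and
    the quotient is again divisible by pi only. *)
Lemma isP_double n : gcount (G := G2) isP (8 * (2 * n)) = gcount (G := G2) isP (8 * n).
Proof.
apply: (gcount_bij (G := G2) (H := G2) (f := fun z : Z * Z => (((z.1 + 7 * z.2) / 4, (z.2 - z.1) / 4)%Z : Z * Z))
  (g := fun z : Z * Z => (((z.1 - 7 * z.2) / 2, (z.1 + z.2) / 2)%Z : Z * Z))).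
- case=> x y; change Z in x, y; move=> Hz Hw; have := G2w (x, y); rewrite Hw /= => E; move: Hz; rewrite /isP /= => Hz.
  have [j Ej] : exists j, (x = 2 * j + 1)%Z by exists (x / 2)%Z; lia.
  have [k Ek] : exists k, (y = x + 4 * k)%Z by exists ((y - x) / 4)%Z; lia.
  have [l El] : exists l, (k = 2 * l + 1)%Z.
    exists (k / 2)%Z; have : (k mod 2 = 0 -> False)%Z; last lia.
    move=> k1; have [l El] : exists l, (k = 2 * l)%Z by exists (k / 2)%Z; lia.
    rewrite Ek El Ej in E; lia.
  have -> : ((x + 7 * y) / 4 = 2 * x + 7 * k)%Z by lia.
  have -> : ((y - x) / 4 = k)%Z by lia.
  split; [by lia | | congr pair; lia].
  apply: Nat2Z.inj; rewrite (G2w (_, _)) /=; rewrite Ek in E; lia.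
- case=> x y; change Z in x, y; move=> Hz Hw; have := G2w (x, y); rewrite Hw /= => E; move: Hz; rewrite /isP /= => Hz.
  have [j Ej] : exists j, (x = 2 * j + 1)%Z by exists (x / 2)%Z; lia.
  have [k Ek] : exists k, (y = x + 4 * k)%Z by exists ((y - x) / 4)%Z; lia.
  have -> : ((x - 7 * y) / 2 = - 3 * x - 14 * k)%Z by lia.
  have -> : ((x + y) / 2 = x + 2 * k)%Z by lia.
  split; [by lia | | congr pair; lia].
  apply: Nat2Z.inj; rewrite (G2w (_, _)) /=; rewrite Ek in E; lia.
Qed.

Lemma p_odd n : odd n -> psi7 n *+ 2 = Phi n.
Proof.
move=> On; rewrite -cfMn -(dilE 7) -gs_isP gsE isP_odd //.
by rewrite /Phi /phi -gs_G2.
Qed.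

Lemma p_double n : psi7 (2 * n)%N = psi7 n.
Proof.
have : psi7 (2 * n)%N *+ 2 = psi7 n *+ 2.
  have E m : psi7 m *+ 2 = (gcount (G := G2) isP (8 * m))%:Z.
    by rewrite -cfMn -(dilE 7) -gs_isP gsE.
  by rewrite !E isP_double.
lia.
Qed.

Lemma nonneg_p : nonneg psi7.
Proof.
apply: nonnegM; first by move=> n; rewrite ler0n.
by apply: nonnegM; [|apply: nonneg_dil]; apply: nonneg_gs.
Qed.

Definition psi7_2 := dil 1 psi7.
Definition oddp := psi7 - psi7_2.

Lemma oddp_odds : odds oddp.
Proof.
move=> n /negbTE On; have [m ->] : exists m, n = (2 * m)%N.
  by exists n./2; rewrite mul2n -[LHS]odd_double_half On.
by rewrite cfD cfN dilE p_double subrr.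
Qed.
Lemma oddp_odd n : odd n -> oddp n = psi7 n.
Proof. by move=> On; rewrite cfD cfN (@evens_dil psi7) ?subr0. Qed.
Lemma nonneg_oddp : nonneg oddp.
Proof.
move=> n; have [/oddp_odd ->|/oddp_odds -> //] := boolP (odd n); exact: nonneg_p.
Qed.
Lemma p_split : psi7 = psi7_2 + oddp.
Proof. by rewrite addrC subrK. Qed.
Lemma P_evens : evens psi7_2. Proof. exact: evens_dil. Qed.
Lemma nonneg_P : nonneg psi7_2. Proof. exact: nonneg_dil nonneg_p. Qed.

Definition isev (x : Z) := (x mod 2 =? 0)%Z.
Definition phi_e : series := gs (G := gsq) isev.
Definition phi_o : series := gs (G := gsq) (predC isev).

Lemma phi_split : phi = phi_e + phi_o.
Proof.
apply: seriesP => n; rewrite cfD !gsE (gcount_predID (G := gsq) _ isev) PoszD; congr (_ + _).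
Qed.

Lemma phi_eE : phi_e = dil 3 phi.
Proof.
apply: seriesP => n; have [/dvdnP[m ->]|Hn] := boolP (4 %| n)%N; last first.
  rewrite dil_ndvd // gsE gcount0 // => x; change Z in x; rewrite /isev /= => Hw.
  apply/negP => Hx; have := wsqE x; rewrite Hw => E; case/negP: Hn.
  have [k Ek] : exists k, (x = 2 * k)%Z by exists (x / 2)%Z; lia.
  apply/dvdnP; exists (Z.to_nat (k * k)); nia.
rewrite mulnC dilE !gsE; congr Posz.
apply: (gcount_bij (G := gsq) (H := gsq) (f := fun x : Z => (x / 2)%Z : Z)
  (g := fun x : Z => (2 * x)%Z : Z)).
- move=> x; change Z in x; rewrite /isev /= => Hx Hw; have := wsqE x; rewrite Hw.
  have [k Ek] : exists k, (x = 2 * k)%Z by exists (x / 2)%Z; lia.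
  have -> : (x / 2 = k)%Z by lia.
  move=> E; split=> //; have := wsqE k; subst x; lia.
- move=> x; change Z in x; rewrite /isev /= => Hx Hw; have := wsqE x; rewrite Hw.
  have := wsqE (2 * x); split; lia.
Qed.

Lemma phi_o_odds : odds phi_o.
Proof.
move=> n On; rewrite gsE gcount0 // => x; change Z in x; rewrite /isev /= => Hw.
apply/negP => Hx; have := wsqE x; rewrite Hw => E.
have [k Ek] : exists k, (x = 2 * k + 1)%Z by exists (x / 2)%Z; lia.
subst x; lia.
Qed.

Lemma phi_e_evens : evens phi_e.
Proof. by rewrite phi_eE (_ : 3 = (2 * 2).-1)%N // -(dil_comp 1 1); apply: evens_dil. Qed.

(* Rotation by 45 degrees: [x^2 + y^2 = 2n] and [u^2 + v^2 = n] have equally many solutions. *)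
Lemma phi_sqr_double n : (phi ^+ 2) (2 * n)%N = (phi ^+ 2) n.
Proof.
rewrite expr2 -(gs_prod (G := gsq) (H := gsq)) !gsE; congr Posz.
have Hw (x y : Z) : Z.of_nat (gw (g := gprod gsq gsq) (x, y)) = (x * x + y * y)%Z.
  by rewrite /= Nat2Z.inj_add !wsqE.
apply: (gcount_bij (G := gprod gsq gsq) (H := gprod gsq gsq)
  (f := fun z : Z * Z => (((z.1 + z.2) / 2)%Z, ((z.1 - z.2) / 2)%Z) : Z * Z)
  (g := fun z : Z * Z => ((z.1 + z.2)%Z, (z.1 - z.2)%Z) : Z * Z)).
- case=> x y; change Z in x, y; move=> _ E; have := Hw x y; rewrite E => E'.
  have [k Ek] : exists k, (x = 2 * k - y)%Z.
    exists ((x + y) / 2)%Z; have : ((x + y) mod 2 = 1 -> False)%Z; last lia.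
    move=> H0; have [m Em] : exists m, (x = 2 * m + 1 - y)%Z by exists ((x + y) / 2)%Z; lia.
    rewrite Em in E'; lia.
  have -> : ((((x, y).1 + (x, y).2) / 2) = k)%Z by rewrite /=; lia.
  have -> : ((((x, y).1 - (x, y).2) / 2) = k - y)%Z by rewrite /=; lia.
  split=> //; last by rewrite /=; congr pair; lia.
  apply: Nat2Z.inj; rewrite Hw; rewrite Ek in E'; lia.
- case=> x y; change Z in x, y; move=> _ E; have := Hw x y; rewrite E => E'.
  split=> //; last by rewrite /=; congr pair; lia.
  by apply: Nat2Z.inj; rewrite Hw /=; lia.
Qed.

Lemma phi_eo_sqr : phi_e ^+ 2 + phi_o ^+ 2 = dil 1 (phi ^+ 2).
Proof.
have Ee : evens (phi_e ^+ 2 + phi_o ^+ 2).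
  apply: evensD; first exact: evensM phi_e_evens phi_e_evens.
  exact: oddsM phi_o_odds phi_o_odds.
apply: seriesP => n; have [On|En] := boolP (odd n).
  by rewrite Ee // evens_dil.
have [m Em] : exists m, n = (2 * m)%N.
  by exists n./2; rewrite mul2n -[LHS]odd_double_half (negbTE En).
have E : phi ^+ 2 = phi_e ^+ 2 + phi_o ^+ 2 + (phi_o * phi_e) *+ 2.
  by rewrite phi_split; ring.
rewrite Em dilE -(phi_sqr_double m) E [RHS]cfD cfMn.
by rewrite (odds_evensM phi_o_odds phi_e_evens) ?mul0rn ?addr0 // -Em.
Qed.

(** This is phi(q) phi(-q) = phi(-q^2)^2, as phi(-q) = [phi_e - phi_o]. *)
Lemma phi_eo_sub : phi_e ^+ 2 - phi_o ^+ 2 = dil 1 ((phi_e - phi_o) ^+ 2).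
Proof.
have E2 : phi_e ^+ 2 = dil 1 (phi_e ^+ 2 + phi_o ^+ 2).
  by rewrite phi_eo_sqr dil_comp phi_eE dilX.
have E1 := phi_eo_sqr.
have -> : phi_e ^+ 2 - phi_o ^+ 2 = phi_e ^+ 2 *+ 2 - (phi_e ^+ 2 + phi_o ^+ 2) by ring.
rewrite E1 {1}E2 -dilMn -dilB phi_split; congr (dil 1 _); move: phi_e phi_o => e o; ring.
Qed.

Definition theta_T : series := phi_e * dil 6 phi_e + phi_o * dil 6 phi_o.
(** The sum of q^(2 N(alpha)) over alpha = (x + y sqrt(-7))/2 with x = y mod 2: even coordinates
    give Phi(q^2), odd ones 4 xi(q^4). *)
Definition theta : series := dil 1 Phi + dil 3 psi7 *+ 4.

Lemma T_evens : evens theta_T.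
Proof.
apply: evensD.
  apply: evensM; first exact: phi_e_evens.
  by move=> n; rewrite phi_eE dil_comp (_ : _.-1 = (2 * 14).-1)%N // -(dil_comp 1 13); exact: evens_dil.
by apply: oddsM; [|apply: odds_dil]; rewrite ?phi_o_odds //; exact: phi_o_odds.
Qed.

Lemma gs_oo : phi_o * dil 6 phi_o = dil 7 (psi7 *+ 4).
Proof.
rewrite -gs_G2 (mulrnA _ 2 2) [psi7 *+ 2 *+ 2]mulr2n dilD -{1}gs_isP -gs_isQ.
apply: seriesP => n; rewrite cfD !gsE -PoszD; congr Posz.
rewrite (gcount_predID (G := G2) _ isP); congr (_ + _)%N;
  apply: eq_gcount => -[x y]; change Z in x, y; move=> _; rewrite /= /isev /isP /isQ /=; lia.
Qed.

Lemma T_dil : theta_T = dil 1 theta.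
Proof.
rewrite /theta_T gs_oo phi_eE /theta !dilMn (dilD 1 (dil 1 Phi)) !dilMn /Phi (dilM 1 phi).
by rewrite (dilM 1 (dil 1 phi)) !dil_comp.
Qed.

Lemma Phi_split : Phi = theta_T + oddp *+ 2.
Proof.
have H : Phi = theta_T + (phi_o * dil 6 phi_e + phi_e * dil 6 phi_o).
  by rewrite /Phi phi_split dilD /theta_T; move: phi_e phi_o => e o; ring.
rewrite H; congr (_ + _); apply: seriesP => n.
have Ho : odds (phi_o * dil 6 phi_e + phi_e * dil 6 phi_o).
  apply: oddsD.
    apply: odds_evensM; first exact: phi_o_odds.
    by move=> k; rewrite phi_eE dil_comp (_ : _.-1 = (2 * 14).-1)%N // -(dil_comp 1 13); exact: evens_dil.
  rewrite mulrC; apply: odds_evensM; last exact: phi_e_evens.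
  by apply: odds_dil => //; exact: phi_o_odds.
have [On|En] := boolP (odd n); last by rewrite Ho // cfMn oddp_odds ?mul0rn.
rewrite cfMn oddp_odd // p_odd // H cfD T_evens ?add0r //.
Qed.

Lemma dil1_fix_neg f : f = - dil 1 f -> f = 0.
Proof.
move=> E; apply: seriesP; elim/ltn_ind => n IH; rewrite cf0.
have [On|En] := boolP (odd n); first by rewrite E cfN evens_dil ?oppr0.
have [m Em] : exists m, n = (2 * m)%N.
  by exists n./2; rewrite mul2n -[LHS]odd_double_half (negbTE En).
have Ef : f n = - f m by rewrite {1}E cfN Em dilE.
case: m => [|m] in Em Ef; first by move: Ef; rewrite Em muln0; lia.
by rewrite Ef IH ?cf0 ?oppr0 // Em; lia.
Qed.

(** The difference D of the two sides satisfies D(q) = - D(q^2), as one sees by splitting Phi(q^2)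
    into its even and odd parts; hence D = 0. *)
Lemma t_split : theta = theta_T + psi7_2 *+ 2.
Proof.
apply/eqP; rewrite -subr_eq0; apply/eqP/dil1_fix_neg.
have E1 : dil 1 (theta - (theta_T + psi7_2 *+ 2)) = theta_T - dil 1 theta_T - dil 3 psi7 *+ 2.
  by rewrite dilB dilD dilMn -T_dil dil_comp opprD addrA.
have E2 : theta = dil 1 theta_T + psi7_2 *+ 2 + dil 3 psi7 *+ 2.
  rewrite /theta Phi_split dilD dilMn /oddp dilB /psi7_2 dil_comp /=; ring.
rewrite E1 E2; ring.
Qed.

(** The identity phi(q) phi(-q) = phi(-q^2)^2, multiplied by its image under q -> q^7, reads Phi(q)
    Phi(-q) = Phi(-q^2)^2. Here Phi(q) and Phi(-q) are [theta_T] plus and minus [oddp *+ 2], and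
    Phi(-q^2) is [theta_T - psi7_2 *+ 2]. *)
Lemma oddp_sqr : oddp ^+ 2 = theta_T * psi7_2 - psi7_2 ^+ 2.
Proof.
have Hd : dil 1 (theta_T - oddp *+ 2) = theta_T - psi7_2 *+ 2.
  have := congr1 (dil 1) t_split; rewrite -T_dil dilD dilMn => ET.
  rewrite dilB dilMn /oddp dilB -/psi7_2 {2}ET; ring.
have H1 : (phi_e - phi_o) * dil 6 (phi_e - phi_o) = theta_T - oddp *+ 2.
  have E : oddp *+ 2 = Phi - theta_T by rewrite Phi_split addrC addKr.
  by rewrite E /Phi /theta_T phi_split dilB dilD; move: phi_e phi_o => e o; ring.
have H2 : (theta_T + oddp *+ 2) * (theta_T - oddp *+ 2) = (theta_T - psi7_2 *+ 2) ^+ 2.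
  rewrite -Hd -{1}Phi_split -H1 /Phi.
  rewrite (dilM 1 (phi_e - phi_o)) dil_comp -(dil_comp 6 1) exprMn -!dilX -phi_eo_sub.
  rewrite phi_split (dilB 6 (phi_e ^+ 2)) (dilB 6 phi_e) !dilX dilD; move: phi_e phi_o => e o; ring.
have H4 : (oddp ^+ 2 - (theta_T * psi7_2 - psi7_2 ^+ 2)) *+ 4 = 0.
  have -> : (oddp ^+ 2 - (theta_T * psi7_2 - psi7_2 ^+ 2)) *+ 4
    = (theta_T - psi7_2 *+ 2) ^+ 2 - (theta_T + oddp *+ 2) * (theta_T - oddp *+ 2) by ring.
  by rewrite H2 subrr.
apply: seriesP => n; move: (congr1 (fun f : series => f n) H4).
rewrite cfMn cfD cfN cf0; lia.
Qed.

Lemma oddp_sqr_dil : oddp ^+ 2 = dil 1 (psi7 * (theta - psi7)).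
Proof. by rewrite oddp_sqr dilM dilB -T_dil -/psi7_2; ring. Qed.

(** * Cubic theta identities *)

Definition cub (a b c d : int) (x y : series) : series :=
  a%:~R * x ^+ 3 + b%:~R * (x ^+ 2 * y) + c%:~R * (x * y ^+ 2) + d%:~R * y ^+ 3.

Lemma cfMint (a : int) (f : series) n : (a%:~R * f) n = a * f n.
Proof.
rewrite mulrzl; case: a => k; rewrite ?NegzE ?mulrNz ?cfN -!pmulrn cfMn.
  by rewrite -mulr_natl natz.
by rewrite -mulr_natl natz mulNr.
Qed.

Lemma dil_int k (a : int) : dil k a%:~R = a%:~R.
Proof. exact: rmorph_int. Qed.

Lemma dil_cub a b c d : dil 1 (cub a b c d theta psi7) = cub a b c d theta_T psi7_2.
Proof.
rewrite /cub !(dilD 1 (_ + _)) (dilD 1 (a%:~R * _)) !(dilM 1 _%:~R) !dil_int !dilX.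
by rewrite (dilM 1 (theta ^+ 2)) (dilM 1 theta) !dilX -T_dil.
Qed.

(** With T, P, h for [theta_T], [psi7_2], [oddp], substitute theta = T + 2P, xi = P + h and h^2 = P
    (T - P). Even powers of h give a cubic form in theta(q^2) and xi(q^2). In the odd part the mixed
    product T P is replaced by h^2 + P^2, so that only squares, which are nonnegative series,
    remain. *)
Lemma cub_step a b c d : cub a b c d theta psi7 =
  dil 1 (cub a (6 * a + b + c) (12 * a + 4 * b + 2 * c + 3 * d)
    (8 * a + 4 * b - 2 * d) theta psi7) +
  oddp * (b%:~R * theta_T ^+ 2 + (4 * b + 2 * c + d)%:~R * oddp ^+ 2
    + (8 * b + 6 * c + 3 * d)%:~R * psi7_2 ^+ 2).
Proof.
rewrite dil_cub t_split p_split /cub.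
rewrite !(intrD, intrM, mulrNz).
move: (a%:~R) (b%:~R) (c%:~R) (d%:~R) theta_T psi7_2 oddp oddp_sqr => {}a {}b {}c {}d theta_T psi7_2 h E.
transitivity (a * (theta_T + psi7_2 *+ 2) ^+ 3 + b * ((theta_T + psi7_2 *+ 2) ^+ 2 * (psi7_2 + h))
  + c * ((theta_T + psi7_2 *+ 2) * (psi7_2 ^+ 2 + psi7_2 * h *+ 2 + h ^+ 2))
  + d * (psi7_2 ^+ 3 + psi7_2 ^+ 2 * h *+ 3 + psi7_2 * h ^+ 2 *+ 3 + h * h ^+ 2)); first ring.
rewrite E; ring.
Qed.

Definition b3 : series := psi7 ^+ 3.
Definition Ys : series := cub 1 0 36 (- 16) theta psi7.

Lemma nonneg_T : nonneg theta_T.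
Proof. by apply: nonnegD; apply: nonnegM; rewrite /phi_e /phi_o; try apply: nonneg_dil; apply: nonneg_gs. Qed.
Lemma nonneg_t : nonneg theta.
Proof.
by move=> n; rewrite -(dilE 1) -T_dil; apply: nonneg_T.
Qed.

(** The quadratic factor that the third dissection leaves at odd indices, divided by 28, is 42 P^2 +
    10 h^2 - 3 T^2. It equals [W 33 7] plus 9 P^2 + 3 h^2, and h times this surplus is 3 xi^3 at odd
    indices. *)
Definition W (a b : int) : series :=
  a%:~R * psi7_2 ^+ 2 + b%:~R * oddp ^+ 2 - 3%:~R * theta_T ^+ 2.

Lemma W_dil a b : W a b =
  dil 1 (a%:~R * psi7 ^+ 2 + b%:~R * (psi7 * (theta - psi7)) - 3%:~R * theta ^+ 2).
Proof.
rewrite /W oddp_sqr_dil dilB (dilD 1 (a%:~R * _)) !(dilM 1 _%:~R) !dil_int !dilX.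
by rewrite -T_dil.
Qed.

Lemma W_step a b : a%:~R * psi7 ^+ 2 + b%:~R * (psi7 * (theta - psi7)) - 3%:~R * theta ^+ 2 =
  W (a + 2 * b - 24) (a - 12) + oddp * ((2 * a)%:~R * psi7_2 + b%:~R * theta_T).
Proof.
rewrite /W t_split p_split !(rmorphD, rmorphB, rmorphM) /=.
move: (a%:~R) (b%:~R) theta_T psi7_2 oddp oddp_sqr => {}a {}b theta_T psi7_2 h E.
transitivity (a * (psi7_2 ^+ 2 + psi7_2 * h *+ 2 + h ^+ 2) + b * (psi7_2 * theta_T + psi7_2 ^+ 2 + h * theta_T - h ^+ 2)
  - 3%:~R * (theta_T ^+ 2 + (theta_T * psi7_2 - psi7_2 ^+ 2) *+ 4 + psi7_2 ^+ 2 *+ 8)); first ring.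
rewrite E; ring.
Qed.

Lemma evens_int (a : int) f : evens f -> evens (a%:~R * f).
Proof. by move=> Hf n On; rewrite cfMint Hf ?mulr0. Qed.
Lemma nonneg_int (a : int) f : 0 <= a -> nonneg f -> nonneg (a%:~R * f).
Proof. by move=> Ha Hf n; rewrite cfMint mulr_ge0. Qed.

Lemma W_evens a b : evens (W a b).
Proof. by rewrite W_dil; apply: evens_dil. Qed.

Lemma evenE n : ~~ odd n -> exists m, n = (2 * m)%N.
Proof. by move=> /negbTE On; exists n./2; rewrite mul2n -[LHS]odd_double_half On. Qed.

(* Descent on [n]: passing from [n] to [n / 2] changes [(a, b)] into [(a + 2b - 24, a - 12)]. *)
Lemma W_ge0 n a b : (0 < n)%N ->
  (30 <= a /\ 6 <= b) \/ (18 <= a /\ 18 <= b) -> 0 <= W a b n.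
Proof.
elim/ltn_ind: n a b => n IH a b n_gt0 Hab.
have [On|/evenE[m Em]] := boolP (odd n); first by rewrite W_evens.
rewrite W_dil Em dilE W_step cfD addr_ge0 //.
  have [m0|m_gt0] := posnP m; first by move: n_gt0; rewrite Em m0.
  (* The quadrants with corners (30, 6) and (18, 18) are exchanged by the step. *)
  apply: IH; lia.
apply: nonnegM; first exact: nonneg_oddp.
apply: nonnegD; apply: nonneg_int; try lia; [exact: nonneg_P | exact: nonneg_T].
Qed.

(** * Values of xi at squares, and the comparison of xi with xi^3 at odd indices *)

Lemma p_sq_ge1 s : (0 < s)%N -> 1 <= psi7 (s ^ 2)%N /\ 1 <= psi7 (7 * s ^ 2)%N.
Proof.
elim/ltn_ind: s => s IH s_gt0.
have [Os|/evenE[k Ek]] := boolP (odd s); last first.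
  have k_gt0 : (0 < k)%N by case: k Ek s_gt0 => // ->.
  have [H1 H7] := IH k ltac:(lia) k_gt0.
  rewrite Ek expnMn (_ : 2 ^ 2 * k ^ 2 = 2 * (2 * k ^ 2))%N; last by lia.
  rewrite !p_double (_ : 7 * (2 * (2 * k ^ 2)) = 2 * (2 * (7 * k ^ 2)))%N; last by lia.
  by rewrite !p_double.
have Phi_ge1 (z : Z * Z) : 1 <= Phi (gw (g := G2) z).
  rewrite /Phi /phi -gs_G2 gsE.
  exact: (gcount_gt0 (G := G2) (P := [pred z | predT z.1 && predT z.2]) (z := z)).
have w1 : gw (g := G2) (Z.of_nat s, 0%Z) = (s ^ 2)%N.
  by apply: Nat2Z.inj; rewrite G2w /=; lia.
have w7 : gw (g := G2) (0%Z, Z.of_nat s) = (7 * s ^ 2)%N.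
  by apply: Nat2Z.inj; rewrite G2w /=; lia.
have := Phi_ge1 (Z.of_nat s, 0%Z); have := Phi_ge1 (0%Z, Z.of_nat s).
rewrite w1 w7 -!p_odd ?oddM ?oddX ?Os //; lia.
Qed.

Definition sg : series := gs (G := gsq) (fun x : Z => (0 <? x)%Z).

Lemma phi_sg : phi = 1 + sg *+ 2.
Proof.
apply: seriesP => n; rewrite cfD cfMn /phi /sg !gsE.
rewrite (gcount_predID (G := gsq) _ (fun x : Z => (0 <? x)%Z)).
rewrite [X in (_ + X)%N](gcount_predID (G := gsq) _ (fun x : Z => (x <? 0)%Z)).
have -> : gcount (G := gsq) [pred z | [pred z0 | predT z0 && ~~ (0 <? z0)%Z] z && (z <? 0)%Z] n
  = gcount (G := gsq) (fun x : Z => (0 <? x)%Z) n.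
  have wN x : wsq (- x) = wsq x by apply: Nat2Z.inj; rewrite !wsqE; lia.
  apply: (gcount_bij (G := gsq) (H := gsq) (f := Z.opp) (g := Z.opp)) => x; change Z in x;
    rewrite /= wN => Hx Hw; split=> //; lia.
have -> : gcount (G := gsq) [pred z | [pred z0 | predT z0 && ~~ (0 <? z0)%Z] z && ~~ (z <? 0)%Z] n
  = (n == 0%N).
  case: eqP => [->|n0].
    by vm_compute.
  rewrite gcount0 // => x; change Z in x; rewrite /= => Hw.
  apply/negP => Hx; have := wsqE x; rewrite Hw; nia.
rewrite cf1 -[X in (X + _)%N]/(gcount (G := gsq) (fun x : Z => (0 <? x)%Z) n); lia.
Qed.

Lemma sg_le1 n : sg n <= 1.
Proof.
rewrite gsE (_ : 1 = (gcount (G := gsq) (fun x : Z => (x =? 0)%Z) 0)%:Z); last first.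
  by vm_compute.
rewrite lez_nat.
apply: (gcount_le (G := gsq) (H := gsq) (f := fun=> 0%Z)) => [x Hx Hw|x y]; first by [].
change Z in x, y => Hx Hy Ex Ey _; have := wsqE x; have := wsqE y.
move: Ex Ey; rewrite /= => -> -> E1 E2; move: Hx Hy; nia.
Qed.

Lemma sg_eq0 n : sg n <> 0 -> exists2 s, (0 < s)%N & n = (s ^ 2)%N.
Proof.
rewrite gsE => H; have : (0 < gcount (G := gsq) (fun x : Z => (0 <? x)%Z) n)%N by lia.
rewrite -has_count => /hasP[x]; rewrite mem_gfib; change Z in x => /eqP Hw Hx.
exists (Z.to_nat x); first lia.
have := wsqE x; move: Hw; rewrite /= => ->; nia.
Qed.

Lemma sq_neq_7sq a b : (0 < a)%N -> (a ^ 2 <> 7 * b ^ 2)%N.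
Proof.
move=> a0 E; have b0 : (0 < b)%N by case: b E => // E; move: a0; rewrite lt0n => /eqP; nia.
have := congr1 (logn 7) E; rewrite lognX lognM ?expn_gt0 ?b0 // lognX.
rewrite (_ : logn 7 7 = 1)%N //; lia.
Qed.

Lemma sg7_eq0 n : dil 6 sg n <> 0 -> exists2 s, (0 < s)%N & n = (7 * s ^ 2)%N.
Proof.
have [/dvdnP[m ->]|/(@dil_ndvd 6) -> //] := boolP (7 %| n)%N.
rewrite mulnC dilE => /sg_eq0[s s0 ->]; by exists s.
Qed.

Lemma sg7_le1 n : dil 6 sg n <= 1.
Proof.
have [/dvdnP[m ->]|Hn] := boolP (7 %| n)%N; last by rewrite dil_ndvd.
by rewrite mulnC dilE sg_le1.
Qed.

Lemma nonneg_sg : nonneg sg. Proof. exact: nonneg_gs. Qed.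
Lemma nonneg_sg7 : nonneg (dil 6 sg). Proof. exact: nonneg_dil nonneg_sg. Qed.

Lemma sg_disjoint n : sg n = 0 \/ dil 6 sg n = 0.
Proof.
have [|/eqP/sg_eq0[s s0 Es]] := eqVneq (sg n) 0; first by left.
right; apply/eqP/negPn/negP => /eqP/sg7_eq0[r r0 Er].
by apply: (@sq_neq_7sq s r s0); rewrite -Es -Er.
Qed.

Lemma oddp_sg m : odd m -> oddp m = sg m + dil 6 sg m + (sg * dil 6 sg) m *+ 2.
Proof.
move=> Om; have EPhi : Phi = 1 + (sg + dil 6 sg + sg * dil 6 sg *+ 2) *+ 2.
  by rewrite /Phi phi_sg dilD dil1 dilMn; move: (dil 6 sg) sg => a b; ring.
have := p_odd Om; rewrite oddp_odd // EPhi (cfD 1) cfMn (cfD (sg + _)) (cfD sg) cfMn cf1.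
by case: m Om => // m _; move: (psi7 _) (sg _) (dil 6 sg _) ((_ * _ : series) _) => a b c d; lia.
Qed.

Lemma b3_odd m : odd m -> b3 m = (oddp * (psi7_2 ^+ 2)) m *+ 3 + (oddp ^+ 3) m.
Proof.
move=> Om; rewrite /b3 p_split.
have -> : (psi7_2 + oddp) ^+ 3 = (psi7_2 * psi7_2 * psi7_2 + psi7_2 * oddp ^+ 2 *+ 3) + (oddp * psi7_2 ^+ 2 *+ 3 + oddp ^+ 3).
  by ring.
have E2 : evens (oddp ^+ 2) by apply: oddsM; apply: oddp_odds.
have E3 : evens (psi7_2 * psi7_2 * psi7_2 + psi7_2 * oddp ^+ 2 *+ 3).
  apply: evensD; first by apply: evensM; [apply: evensM|]; exact: P_evens.
  by apply: evensMn; apply: evensM E2; exact: P_evens.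
by rewrite cfD E3 // add0r cfD cfMn.
Qed.

Lemma P2_ge1 s : (0 < s)%N -> ~~ odd s -> 1 <= (psi7_2 ^+ 2) (s ^ 2)%N /\ 1 <= (psi7_2 ^+ 2) (7 * s ^ 2)%N.
Proof.
move=> s0 /evenE[k Ek]; have k0 : (0 < k)%N by case: k Ek s0 => // ->.
have [H1 H7] := p_sq_ge1 k0.
have P1 : 1 <= psi7_2 (2 * k ^ 2)%N by rewrite dilE.
have P7 : 1 <= psi7_2 (2 * (7 * k ^ 2))%N by rewrite dilE.
rewrite Ek expr2 (_ : (2 * k) ^ 2 = 2 * k ^ 2 + 2 * k ^ 2)%N; last by lia.
rewrite (_ : 7 * (2 * k ^ 2 + 2 * k ^ 2) = 2 * (7 * k ^ 2) + 2 * (7 * k ^ 2))%N; last by lia.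
by split; apply: cfM_term_ge1 => //; exact: nonneg_P.
Qed.

Lemma oddp_ge1 s : odd s -> 1 <= oddp (s ^ 2)%N /\ 1 <= oddp (7 * s ^ 2)%N.
Proof.
by move=> Os; rewrite !oddp_odd ?oddM ?oddX ?Os //; apply: p_sq_ge1; case: s Os.
Qed.

(** A number is not both a square and 7 times a square, so at most one product on the left is
    nonzero, and it is at most 1. If it is 1, then i and j are a square and 7 times a square in some
    order, where both factors on the right are at least 1. *)
Lemma sg_term_le i j : odd i -> ~~ odd j ->
  sg i * dil 6 sg j + dil 6 sg i * sg j <= oddp i * (psi7_2 ^+ 2) j.
Proof.
move=> Oi Ej.
have pos : 0 <= oddp i * (psi7_2 ^+ 2) j.
  by rewrite mulr_ge0 ?nonneg_oddp // nonnegX //; apply: nonneg_P.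
have odd_sq k s : odd k -> k = (s ^ 2)%N -> odd s by move=> + Ek; rewrite Ek oddX.
have odd_sq7 k s : odd k -> k = (7 * s ^ 2)%N -> odd s by move=> + Ek; rewrite Ek oddM oddX.
have ev_sq k s : ~~ odd k -> k = (s ^ 2)%N -> ~~ odd s by move=> + Ek; rewrite Ek oddX.
have ev_sq7 k s : ~~ odd k -> k = (7 * s ^ 2)%N -> ~~ odd s by move=> + Ek; rewrite Ek oddM oddX.
have H a b : 0 <= a -> 0 <= b -> a <= 1 -> b <= 1 -> 
  (a <> 0 -> b <> 0 -> 1 <= oddp i * (psi7_2 ^+ 2) j) -> a * b <= oddp i * (psi7_2 ^+ 2) j :> int.
  move=> a0 b0 a1 b1 Hab.
  have [->|/eqP na] := eqVneq a 0; first by rewrite mul0r.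
  have [->|/eqP nb] := eqVneq b 0; first by rewrite mulr0.
  apply: le_trans (Hab na nb); rewrite -[1]mulr1; exact: ler_pM.
have Hmul (x y : int) : 1 <= x -> 1 <= y -> 1 <= x * y by nia.
case: (sg_disjoint i) => ->; rewrite mul0r ?add0r ?addr0; apply: H;
  rewrite ?nonneg_sg7 ?nonneg_sg ?sg_le1 ?sg7_le1 //.
  move=> /sg7_eq0[r r0 Er] /sg_eq0[s s0 Es]; apply: Hmul.
    by rewrite Er; case: (oddp_ge1 (odd_sq7 _ _ Oi Er)).
  by rewrite Es; case: (P2_ge1 s0 (ev_sq _ _ Ej Es)).
move=> /sg_eq0[r r0 Er] /sg7_eq0[s s0 Es]; apply: Hmul.
  by rewrite Er; case: (oddp_ge1 (odd_sq _ _ Oi Er)).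
by rewrite Es; case: (P2_ge1 s0 (ev_sq7 _ _ Ej Es)).
Qed.

(** Both convolutions are symmetrized under i -> m - i; exactly one of i and m - i is odd, and
    [sg_term_le] compares the pair. *)
Lemma sgsg7_le m : odd m -> (sg * dil 6 sg) m <= (oddp * psi7_2 ^+ 2) m.
Proof.
move=> Om; rewrite -(@ler_pMn2r _ 2) //.
have E (f g : series) : (f * g) m *+ 2 = \sum_(i < m.+1) (f i * g (m - i)%N + g i * f (m - i)%N).
  by rewrite big_split /= -!cfM mulr2n [in X in _ + X]mulrC.
rewrite !E; apply: ler_sum => i _.
have Oi : odd (m - i) = ~~ odd i by rewrite oddB ?leq_ord // Om; case: (odd i).
have NP n : 0 <= (psi7_2 ^+ 2) n by apply: nonnegX; apply: nonneg_P.
have [Hi|Hi] := boolP (odd i).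
  apply: le_trans (sg_term_le Hi _) _; first by rewrite Oi Hi.
  by rewrite lerDl mulr_ge0 // nonneg_oddp.
have H : odd (m - i) by rewrite Oi.
have := sg_term_le H Hi.
have : 0 <= oddp i * (psi7_2 ^+ 2) (m - i)%N by rewrite mulr_ge0 ?nonneg_oddp.
move: (sg i) (sg _) (dil 6 sg i) (dil 6 sg _) (oddp i) (oddp _) ((psi7_2 ^+ 2) i) ((psi7_2 ^+ 2) _).
by move=> a b c d e f g h; lia.
Qed.

Lemma p_even_square_half B : (0 < B)%N -> ~~ odd B ->
  exists2 h, (B ^ 2 = h + h)%N & 1 <= psi7 h.
Proof.
move=> B0 /evenE[k Ek]; exists (2 * k ^ 2)%N; first by rewrite Ek; lia.
by rewrite p_double; case: (@p_sq_ge1 k); case: k Ek B0 => // ->.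
Qed.

(** Let x be the number of ways to write m as a^2 + 7 b^2 with a, b > 0. Then [oddp m] is 2x, plus 1
    if m is a square or 7 times a square. As 3x <= [b3 m], only [1 <= b3 m] is needed in the second
    case, and it comes from three indices of sum m at which xi is positive. *)
Lemma oddp_le_b3 m : odd m -> (1 < m)%N -> oddp m <= b3 m.
Proof.
move=> Om m1; have b3_ge : (sg * dil 6 sg) m *+ 3 <= b3 m.
  rewrite b3_odd //; apply: le_trans (_ : (oddp * psi7_2 ^+ 2) m *+ 3 <= _).
    by rewrite lerMn2r sgsg7_le ?orbT.
  by rewrite lerDl nonnegX //; apply: nonneg_oddp.
have Np := nonneg_p; have Npp : nonneg (psi7 * psi7) by apply: nonnegM.
have triple i j k : 1 <= psi7 i -> 1 <= psi7 j -> 1 <= psi7 k -> 1 <= b3 (i + j + k)%N.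
  move=> pi pj pk; rewrite /b3 (_ : psi7 ^+ 3 = psi7 * psi7 * psi7); last by ring.
  by apply: cfM_term_ge1 => //; apply: cfM_term_ge1.
have b3_pos : sg m + dil 6 sg m = 0 \/ 1 <= b3 m.
  have [H1|/eqP/sg_eq0[s s0 Es]] := eqVneq (sg m) 0.
    rewrite H1 add0r; have [|/eqP/sg7_eq0[s s0 Es]] := eqVneq (dil 6 sg m) 0; first by left.
    right; have [H _] := p_sq_ge1 s0.
    rewrite Es (_ : 7 * s ^ 2 = 2 * (2 * s ^ 2) + 2 * s ^ 2 + s ^ 2)%N; last by lia.
    by apply: triple; rewrite ?p_double.
  right; have Os : odd s by move: Om; rewrite Es oddX.
  have s1 : (1 < s)%N by case: s Es Os {s0} => [|[|]] // E; move: m1; rewrite E.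
  have [A [B [C [Esq A0 B0 HC]]]] := three_squares Os s1.
  have [pA _] := p_sq_ge1 A0; have [pB _] := p_sq_ge1 B0; rewrite Es Esq.
  have [C0|C0] := posnP C; last by apply: triple => //; case: (p_sq_ge1 C0).
  rewrite C0 addn0; have [h -> ph] := p_even_square_half B0 (HC C0).
  by rewrite addnA; apply: triple.
rewrite oddp_sg //; have := nonneg_sg m; have := nonneg_sg7 m; have := sg_le1 m; have := sg7_le1 m.
have Nss : 0 <= (sg * dil 6 sg) m by apply: nonnegM; [exact: nonneg_sg | exact: nonneg_sg7].
case: (sg_disjoint m); case: b3_pos; move: Nss b3_ge; lia.
Qed.

(** * Nonnegativity of the cubic forms *)

Lemma cub_stepE a b c d b' c' d' e f g :
  b' = 6 * a + b + c -> c' = 12 * a + 4 * b + 2 * c + 3 * d ->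
  d' = 8 * a + 4 * b - 2 * d ->
  e = b -> f = 4 * b + 2 * c + d -> g = 8 * b + 6 * c + 3 * d ->
  cub a b c d theta psi7 = dil 1 (cub a b' c' d' theta psi7) +
    oddp * (e%:~R * theta_T ^+ 2 + f%:~R * oddp ^+ 2 + g%:~R * psi7_2 ^+ 2).
Proof. by move=> -> -> -> -> -> ->; exact: cub_step. Qed.

Lemma nonneg_cub a b c d : 0 <= a -> 0 <= b -> 0 <= c -> 0 <= d ->
  nonneg (cub a b c d theta psi7).
Proof.
have Nt := nonneg_t; have Np := nonneg_p.
move=> a0 b0 c0 d0; apply: nonnegD; last by apply: nonneg_int => //; exact: nonnegX.
apply: nonnegD; last by apply: nonneg_int => //; apply: nonnegM => //; exact: nonnegX.
apply: nonnegD; last by apply: nonneg_int => //; apply: nonnegM => //; exact: nonnegX.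
by apply: nonneg_int => //; exact: nonnegX.
Qed.

Lemma nonneg_odd_part (a b c : int) : 0 <= a -> 0 <= b -> 0 <= c ->
  nonneg (oddp * (a%:~R * theta_T ^+ 2 + b%:~R * oddp ^+ 2 + c%:~R * psi7_2 ^+ 2)).
Proof.
move=> a0 b0 c0; apply: nonnegM; first exact: nonneg_oddp.
by apply: nonnegD; [apply: nonnegD|]; apply: nonneg_int => //; apply: nonnegX;
   [exact: nonneg_T | exact: nonneg_oddp | exact: nonneg_P].
Qed.

Lemma odd_part_even (a b c : int) n : ~~ odd n ->
  (oddp * (a%:~R * theta_T ^+ 2 + b%:~R * oddp ^+ 2 + c%:~R * psi7_2 ^+ 2)) n = 0.
Proof.
apply: odds_evensM; first exact: oddp_odds.
apply: evensD; [apply: evensD|]; apply: evens_int.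
- by apply: evensM; exact: T_evens.
- by apply: oddsM; exact: oddp_odds.
- by apply: evensM; exact: P_evens.
Qed.

Lemma W_0 a b : W a b 0%N = - 3.
Proof.
have P0 : psi7_2 0%N = 0 by rewrite (dilE 1 psi7 0) /psi7 sXM_0.
have o0 : oddp 0%N = 0 by rewrite oddp_odds.
have s0 : sg 0%N = 0.
  by apply/eqP/negPn/negP => /eqP/sg_eq0[s s_gt0 /esym/eqP]; rewrite expn_eq0; case: s s_gt0.
have T0 : theta_T 0%N = 1.
  have := congr1 (fun f : series => f 0%N) Phi_split; rewrite cfD cfMn o0 mul0rn addr0 => <-.
  by rewrite cfM big_ord1 subn0 (dilE 6 phi 0) phi_sg cfD cfMn s0.
have sqr0 (f : series) : (f ^+ 2) 0%N = f 0%N * f 0%N by rewrite cfM big_ord1.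
by rewrite /W !cfD cfN !cfMint !sqr0 P0 o0 T0; lia.
Qed.

(** At odd k the coefficient is 28 times that of [oddp * W 33 7] plus 3 [b3 k]. Only the constant
    term - 3 of [W 33 7] is negative, so the loss is at most 3 [oddp k]. At k = 1 the claim fails:
    [oddp] is 1 and [b3] is 0 there. At even k one more dissection has only nonnegative
    coefficients. *)
Lemma cub_half_ge0 k : k <> 1%N -> 0 <= cub 1 (- 84) 372 (- 128) theta psi7 k.
Proof.
move=> k1.
rewrite (@cub_stepE _ _ _ _ 294 36 (- 72) (- 84) 280 1176) //.
have [Ok|/evenE[m Em]] := boolP (odd k).
  rewrite cfD evens_dil // add0r.
  have -> : oddp * ((- 84)%:~R * theta_T ^+ 2 + 280%:~R * oddp ^+ 2 + 1176%:~R * psi7_2 ^+ 2)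
    = (oddp * W 33 7 + (oddp * psi7_2 ^+ 2 *+ 3 + oddp ^+ 3) *+ 3) *+ 28.
    by rewrite /W; ring.
  rewrite cfMn cfD cfMn (cfD (_ *+ 3)) cfMn -b3_odd //.
  have : - 3 * oddp k <= (oddp * W 33 7) k.
    rewrite cfM big_ord_recr [nat_of_ord ord_max]/= subnn W_0 mulrC lerDr sumr_ge0 // => i _.
    apply: mulr_ge0; first exact: nonneg_oddp.
    by apply: W_ge0; [rewrite subn_gt0; exact: (ltn_ord i) | left].
  have := @oddp_le_b3 k Ok ltac:(by case: (k) k1 Ok => [|[]]).
  move: (oddp k) (b3 k) ((_ * _ : series) k) => x y z; lia.
rewrite cfD addr_ge0 //; last first.
  by rewrite odd_part_even // Em oddM.
rewrite Em dilE (@cub_stepE _ _ _ _ 336 1044 1328 294 1176 2352) // cfD addr_ge0 //.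
  by apply: nonneg_dil; exact: nonneg_cub.
exact: nonneg_odd_part.
Qed.

(** For the form (1, 0, 36, d) the odd part of the dissection is governed by 72 + d, and vanishes
    exactly at d = - 72. Two halvings bring the excluded index 4 down to 1. *)
Lemma Ys_ge n : n <> 4%N -> b3 n *+ 56 <= Ys n.
Proof.
move=> n4; rewrite -subr_ge0.
have -> : Ys n - b3 n *+ 56 = cub 1 0 36 (- 72) theta psi7 n.
  rewrite -cfMn -cfN -cfD; congr (cf _ n); rewrite /Ys /b3 /cub; ring.
rewrite (@cub_stepE _ _ _ _ 42 (- 132) 152 0 0 0) //.
rewrite !mul0r !addr0 mulr0 addr0.
have [On|/evenE[m Em]] := boolP (odd n); first by rewrite evens_dil.
have m2 : m <> 2%N by move=> E; apply: n4; rewrite Em E.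
rewrite Em dilE (@cub_stepE _ _ _ _ (- 84) 372 (- 128) 42 56 0) // cfD addr_ge0 //; last first.
  exact: nonneg_odd_part.
have [Om|/evenE[k Ek]] := boolP (odd m); first by rewrite evens_dil.
by rewrite Ek dilE cub_half_ge0 // => E; apply: m2; rewrite Ek E.
Qed.

(** * Vectors with prescribed residues modulo 7 *)

Definition vec7 : Type := Z * (Z * (Z * (Z * (Z * (Z * Z))))).
Definition G7 : gset :=
  gprod gsq (gprod gsq (gprod gsq (gprod gsq (gprod gsq (gprod gsq gsq))))).

Lemma G7w a b c d e f g :
  Z.of_nat (gw (g := G7) (a, (b, (c, (d, (e, (f, g))))))) =
  (a * a + b * b + c * c + d * d + e * e + f * f + g * g)%Z.
Proof. rewrite /=; rewrite !Nat2Z.inj_add !wsqE; lia. Qed.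

Definition cg (x y : Z) := ((x - y) mod 7 =? 0)%Z.

(* Coordinates are indexed by -3, ..., 3. *)
Definition cls (s t : Z) (w : vec7) :=
  let: (a, (b, (c, (d, (e, (f, g)))))) := w in
  [&& (a + b + c + d + e + f + g =? 0)%Z, cg a (t - 3 * s), cg b (t - 2 * s),
   cg c (t - s), cg d t, cg e (t + s), cg f (t + 2 * s) & cg g (t + 3 * s)].

Definition m1 (w : vec7) : Z :=
  let: (a, (b, (c, (d, (e, (f, g)))))) := w in
  (- 3 * a - 2 * b - c + e + 2 * f + 3 * g)%Z.

Definition sum7 (w : vec7) : Z :=
  let: (a, (b, (c, (d, (e, (f, g)))))) := w in (a + b + c + d + e + f + g)%Z.

Definition shift7 (w : vec7) : vec7 :=
  let: (a, (b, (c, (d, (e, (f, g)))))) := w in (b, (c, (d, (e, (f, (g, a)))))).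
Definition mult7 (w : vec7) : vec7 :=
  let: (a, (b, (c, (d, (e, (f, g)))))) := w in (b, (e, (a, (d, (g, (c, f)))))).

Lemma eqG7w (w w' : vec7) : 
  Z.of_nat (gw (g := G7) w) = Z.of_nat (gw (g := G7) w') ->
  gw (g := G7) w = gw (g := G7) w'.
Proof. exact: Nat2Z.inj. Qed.

Ltac vec7 w a b c d e f g :=
  case: w => [a [b [c [d [e [f g]]]]]]; change Z in a, b, c, d, e, f, g.

Lemma shift7w (w : vec7) : gw (g := G7) (shift7 w) = gw (g := G7) w.
Proof. by vec7 w a b c d e f g; apply: eqG7w; rewrite !G7w; lia. Qed.
Lemma mult7w (w : vec7) : gw (g := G7) (mult7 w) = gw (g := G7) w.
Proof. by vec7 w a b c d e f g; apply: eqG7w; rewrite !G7w; lia. Qed.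
Lemma shift7_inj : injective shift7.
Proof.
move=> w w'; vec7 w a b c d e f g; vec7 w' a' b' c' d' e' f' g'.
by case=> -> -> -> -> -> -> ->.
Qed.
Lemma mult7_inj : injective mult7.
Proof.
move=> w w'; vec7 w a b c d e f g; vec7 w' a' b' c' d' e' f' g'.
by case=> -> -> -> -> -> -> ->.
Qed.

Definition ccls (n : nat) (s t : Z) : nat := gcount (G := G7) (cls s t) n.

Lemma ccls_eq n s t s' t' : ((s - s') mod 7 = 0)%Z -> ((t - t') mod 7 = 0)%Z ->
  ccls n s t = ccls n s' t'.
Proof.
move=> Hs Ht; apply: eq_gcount => w _; vec7 w a b c d e f g; rewrite /cls /cg.
have [k Ek] : exists k, (s = s' + 7 * k)%Z by exists ((s - s') / 7)%Z; lia.
have [l El] : exists l, (t = t' + 7 * l)%Z by exists ((t - t') / 7)%Z; lia.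
rewrite Ek El; congr [&& _, _, _, _, _, _, _ & _]; lia.
Qed.

Lemma ccls_shift n s t : (ccls n s t <= ccls n s (t + s))%N.
Proof.
apply: (gcount_le (G := G7) (H := G7) (f := shift7)) => [w Hw Ew|w w' _ _ _ _];
  last exact: shift7_inj.
split; last by rewrite shift7w.
move: Hw {Ew}; vec7 w a b c d e f g; rewrite /cls /cg /=; lia.
Qed.

Lemma ccls_mult n s t : (ccls n s t <= ccls n (3 * s) t)%N.
Proof.
apply: (gcount_le (G := G7) (H := G7) (f := mult7)) => [w Hw Ew|w w' _ _ _ _];
  last exact: mult7_inj.
split; last by rewrite mult7w.
move: Hw {Ew}; vec7 w a b c d e f g; rewrite /cls /cg /=; lia.
Qed.

(** 3 is a primitive root modulo 7, so the inequalities of [ccls_mult] close up along 1, 3, 2, 6, 4,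
    5, 1 and are equalities. *)
Lemma ccls_s n s t : ~~ cg s 0 -> ccls n s t = ccls n 1 t.
Proof.
move=> Hs; have step s1 s2 : ((3 * s1 - s2) mod 7 = 0)%Z -> (ccls n s1 t <= ccls n s2 t)%N.
  by move=> H; rewrite -(@ccls_eq n (3 * s1) t s2 t) ?ccls_mult //; lia.
have h1 := @step 1%Z 3%Z erefl; have h2 := @step 3%Z 2%Z erefl; have h3 := @step 2%Z 6%Z erefl.
have h4 := @step 6%Z 4%Z erefl; have h5 := @step 4%Z 5%Z erefl; have h6 := @step 5%Z 1%Z erefl.
have [r Hr] : exists r, [/\ (r = s mod 7)%Z, (0 < r < 7)%Z & ((s - r) mod 7 = 0)%Z].
  by exists (s mod 7)%Z; rewrite /cg in Hs; split; lia.
case: Hr => _ r7 Er; rewrite (@ccls_eq n s t r t) //; last by lia.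
have : (r = 1 \/ r = 2 \/ r = 3 \/ r = 4 \/ r = 5 \/ r = 6)%Z by lia.
by case=> [|[|[|[|[]]]]] ->; lia.
Qed.

Lemma ccls_st n s t : ~~ cg s 0 -> ccls n s t = ccls n 1 0.
Proof.
move=> /ccls_s ->.
have step t1 t2 : ((t1 + 1 - t2) mod 7 = 0)%Z -> (ccls n 1 t1 <= ccls n 1 t2)%N.
  by move=> H; rewrite -(@ccls_eq n 1 (t1 + 1) 1 t2) ?ccls_shift.
have h0 := @step 0%Z 1%Z erefl.
have h1 := @step 1%Z 2%Z erefl; have h2 := @step 2%Z 3%Z erefl; have h3 := @step 3%Z 4%Z erefl.
have h4 := @step 4%Z 5%Z erefl; have h5 := @step 5%Z 6%Z erefl; have h6 := @step 6%Z 0%Z erefl.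
rewrite (@ccls_eq n 1 t 1 (t mod 7)) //; last by lia.
have : (t mod 7 = 0 \/ t mod 7 = 1 \/ t mod 7 = 2 \/ t mod 7 = 3 \/ t mod 7 = 4
  \/ t mod 7 = 5 \/ t mod 7 = 6)%Z by lia.
by case=> [|[|[|[|[|[]]]]]] ->; lia.
Qed.

Definition mres (x : Z) : nat := Z.to_nat (x mod 7).
Lemma mres_lt x : (mres x < 7)%N. Proof. rewrite /mres; lia. Qed.
Lemma mresE x (i : nat) : (i < 7)%N -> (mres x == i) = cg x (Z.of_nat i).
Proof. rewrite /mres /cg; lia. Qed.

Definition const7 (w : vec7) :=
  let: (a, (b, (c, (d, (e, (f, g)))))) := w in
  [&& (a + b + c + d + e + f + g =? 0)%Z, cg a d, cg b d, cg c d, cg e d, cg f d & cg g d].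

Definition lam (w : vec7) :=
  let: (a, (b, (c, (d, (e, (f, g)))))) := w in
  [&& (a + b + c + d + e + f + g =? 0)%Z, cg a (d - 3 * (e - d)), cg b (d - 2 * (e - d)),
   cg c (d - (e - d)), cg f (d + 2 * (e - d)) & cg g (d + 3 * (e - d))].

Definition cconst n : nat := gcount (G := G7) const7 n.
Definition clam n : nat := gcount (G := G7) lam n.

Definition tcoord (w : vec7) : Z := w.2.2.2.1.
Definition scoord (w : vec7) : Z := (w.2.2.2.2.1 - w.2.2.2.1)%Z.

Lemma cconst_sum n : cconst n = (\sum_(i < 7) ccls n 0 (Z.of_nat i))%N.
Proof.
rewrite /cconst (gcount_partition (G := G7) (k := 7) (f := fun w => mres (tcoord w))) => [|w _];
  last exact: mres_lt.
apply: eq_bigr => i _; apply: eq_gcount => w _; rewrite [LHS]/=.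
rewrite mresE ?ltn_ord //; vec7 w a b c d e f g; rewrite /tcoord /cls /const7 /cg /=.
apply/idP/idP; lia.
Qed.

Lemma clam_sum n : clam n = (42 * ccls n 1 0 + cconst n)%N.
Proof.
rewrite /clam (gcount_partition (G := G7) (k := 7) (f := fun w => mres (scoord w))) => [|w _];
  last exact: mres_lt.
have H (i : 'I_7) : 
  gcount (G := G7) [pred z | lam z && (mres (scoord z) == i)] n =
   (\sum_(j < 7) ccls n (Z.of_nat i) (Z.of_nat j))%N.
  rewrite (gcount_partition (G := G7) (k := 7) (f := fun w => mres (tcoord w))) => [|w _];
    last exact: mres_lt.
  apply: eq_bigr => j _; apply: eq_gcount => w _; rewrite [LHS]/=.
  rewrite !mresE ?ltn_ord //; vec7 w a b c d e f g; rewrite /tcoord /scoord /cls /lam /cg /=.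
  apply/idP/idP; lia.
rewrite (eq_bigr _ (fun i _ => H i)) big_ord_recl -cconst_sum addnC; congr (_ + _)%N.
rewrite (eq_bigr (fun=> 7 * ccls n 1 0)%N) => [|i _].
  by rewrite sum_nat_const card_ord mulnA.
rewrite (eq_bigr (fun=> ccls n 1 0)%N) => [|j _]; first by rewrite sum_nat_const card_ord.
apply: ccls_st; rewrite /cg lift0; have := ltn_ord i; lia.
Qed.

(** On a constant class w.rho, which is [m1 w], is divisible by 7; its quotient u modulo 7 refines
    the class. *)
Definition dcls (n : nat) (t u : Z) : nat :=
  gcount (G := G7) [pred w | cls 0 t w && ((m1 w - 7 * u) mod 49 =? 0)%Z] n.

Lemma dcls_sum n t : ccls n 0 t = (\sum_(i < 7) dcls n t (Z.of_nat i))%N.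
Proof.
rewrite /ccls (gcount_partition (G := G7) (k := 7) (f := fun w => mres (m1 w / 7))) => [|w _];
  last exact: mres_lt.
apply: eq_bigr => i _; apply: eq_gcount => w _; rewrite [LHS]/= [RHS]/=.
case: (boolP (cls 0 t w)) => //= Hw; rewrite mresE ?ltn_ord //.
have : (m1 w mod 7 = 0)%Z by move: Hw; vec7 w a b c d e f g; rewrite /cls /m1 /cg; lia.
rewrite /cg; move: (m1 w) => x; lia.
Qed.

(** As the coordinates sum to 0, a cyclic shift adds 7 a to [m1], where a = t mod 7. *)
Lemma dcls_shift n t u : (dcls n t u <= dcls n t (u + t))%N.
Proof.
apply: (gcount_le (G := G7) (H := G7) (f := shift7)) => [w Hw Ew|w w' _ _ _ _];
  last exact: shift7_inj.
split; last by rewrite shift7w.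
move: Hw {Ew}; vec7 w a b c d e f g; rewrite /cls /cg /m1 /=; lia.
Qed.

(* The reflection [w - (w.rho / 14) rho - (w.kappa / 2) kappa] in the orthogonal vectors
   [rho = (-3, ..., 3)] and [kappa = (-1, 0, 1, 0, 1, 0, -1)], with [h = w.kappa] and
   [w.rho = 7 (h + 2 k)]. *)
Definition refl7 (w : vec7) : vec7 :=
  let: (a, (b, (c, (d, (e, (f, g)))))) := w in
  let h := (- a + c + e - g)%Z in
  let k := ((m1 w / 7 - h) / 2)%Z in
  ((a + 2 * h + 3 * k)%Z, ((b + h + 2 * k)%Z, ((c + k)%Z, (d, ((e - h - k)%Z,
   ((f - h - 2 * k)%Z, (g - h - 3 * k)%Z)))))).

(** [rho] and [kappa] agree modulo 2, so h and w.rho / 7 have the same parity. This makes k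
    integral, and is the reason why [kappa] accompanies [rho]: the term (w.rho / 14) rho alone can
    be half-integral. *)
Lemma refl7_spec (w : vec7) : (m1 w mod 7 = 0)%Z ->
  let: (a, (b, (c, (d, (e, (f, g)))))) := w in
  exists h k, [/\ (h = - a + c + e - g)%Z, (m1 w = 7 * (h + 2 * k))%Z &
   refl7 w = ((a + 2 * h + 3 * k)%Z, ((b + h + 2 * k)%Z, ((c + k)%Z, (d, ((e - h - k)%Z,
   ((f - h - 2 * k)%Z, (g - h - 3 * k)%Z))))))].
Proof.
vec7 w a b c d e f g; rewrite /m1 /refl7 => H.
exists (- a + c + e - g)%Z, (((- 3 * a - 2 * b - c + e + 2 * f + 3 * g) / 7 - (- a + c + e - g)) / 2)%Z.
split=> //; rewrite /m1; lia.
Qed.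

(** On a constant class h = 0 mod 7, so 2k = u, and coordinate i moves by - k i = 3 u i modulo 7. *)
Lemma refl7_class n t u : ~~ cg u 0 -> (dcls n t u <= ccls n (3 * u) t)%N.
Proof.
move=> Hu; apply: (gcount_le (G := G7) (H := G7) (f := refl7)).
- move=> w /= /andP[Hw Hm] Ew.
  have Hm7 : (m1 w mod 7 = 0)%Z by move: (m1 w) Hm => x; lia.
  have := refl7_spec Hm7; move: Hw Hm Ew {Hm7}; vec7 w a b c d e f g => Hw Hm Ew.
  case=> h [k [Eh Ek ->]]; split.
    move: Hw Hm; rewrite Ek /cls /cg; rewrite /m1 in Ek; clear Ew Hu.
    have [l El] : exists l, (h = 7 * l)%Z -> True by exists 0%Z.
    move=> Hw Hm.
    have Hh : (h mod 7 = 0)%Z by rewrite Eh; lia.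
    have Hk : ((h + 2 * k - u) mod 7 = 0)%Z by lia.
    have Hc : (- 3 * a - 2 * b - c + e + 2 * f + 3 * g = 7 * (h + 2 * k))%Z by [].
    clear Ek El Eh Hm Hc; repeat (apply/andP; split); lia.
  rewrite -Ew; apply: eqG7w; rewrite !G7w; rewrite /m1 in Ek.
  have Ec : (c = - a - b + 2 * g + f - 3 * h - 7 * k)%Z by lia.
  have Ee : (e = h + a - c + g)%Z by lia.
  by clear Hw Hm Ew Ek Eh; subst e c; ring.
- move=> w w' /= /andP[_ Hm] /andP[_ Hm'] _ _.
  have Hm7 : (m1 w mod 7 = 0)%Z by move: (m1 w) Hm => x; lia.
  have Hm7' : (m1 w' mod 7 = 0)%Z by move: (m1 w') Hm' => x; lia.
  have := refl7_spec Hm7; have := refl7_spec Hm7'; clear Hm Hm' Hm7 Hm7'.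
  vec7 w a b c d e f g; vec7 w' a' b' c' d' e' f' g'.
  rewrite /m1; case=> h' [k' [Eh' Ek' ->]] [h [k [Eh Ek ->]]] [] *.
  have Ehh : h = h' by lia.
  have Ekk : k = k' by lia.
  by repeat congr pair; lia.
Qed.

Lemma dcls_le n t u : ~~ cg u 0 -> (dcls n t u <= ccls n 1 0)%N.
Proof.
move=> Hu; apply: leq_trans (refl7_class n t Hu) _.
by rewrite ccls_st //; move: Hu; rewrite /cg; lia.
Qed.

(** The reflection does not apply to u = 0; as t is nonzero, a shift first carries that class to u =
    t. *)
Lemma ccls0_le n t : ~~ cg t 0 -> (ccls n 0 t <= 7 * ccls n 1 0)%N.
Proof.
move=> Ht; rewrite dcls_sum; apply: leq_trans (_ : (\sum_(i < 7) ccls n 1 0 <= _)%N).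
  apply: leq_sum => i _; have [Hi|Hi] := boolP (cg (Z.of_nat i) 0); last exact: dcls_le.
  apply: leq_trans (dcls_shift _ _ _) (dcls_le _ _ _).
  by move: Ht Hi; rewrite /cg; lia.
by rewrite sum_nat_const card_ord.
Qed.

(** * Constant classes *)

Lemma ccls0_norm n t : (0 < ccls (14 * n) 0 t)%N -> ((2 * Z.of_nat n + t * t) mod 7 = 0)%Z.
Proof.
rewrite -has_count => /hasP[w]; rewrite mem_gfib => /eqP Ew.
have := congr1 Z.of_nat Ew; clear Ew; vec7 w a b c d e f g; rewrite G7w /cls /cg => E H.
have lift x : ((x - (t + 0)) mod 7 = 0 -> exists z, x = t + 7 * z)%Z.
  by move=> Hx; exists ((x - t) / 7)%Z; lia.
have [z1 E1] := lift a ltac:(clear - H; lia); have [z2 E2] := lift b ltac:(clear - H; lia).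
have [z3 E3] := lift c ltac:(clear - H; lia); have [z4 E4] := lift d ltac:(clear - H; lia).
have [z5 E5] := lift e ltac:(clear - H; lia); have [z6 E6] := lift f ltac:(clear - H; lia).
have [z7 E7] := lift g ltac:(clear - H; lia).
(* For w = t + 7 z the entries of z sum to - t, so the norm is 7 t^2 - 14 t^2 + 49 |z|^2. *)
have E0 : (z1 = - t - z2 - z3 - z4 - z5 - z6 - z7)%Z by clear E; lia.
have Ez : (2 * Z.of_nat n + t * t = 7 * (z1 * z1 + z2 * z2 + z3 * z3 + z4 * z4 + z5 * z5 + z6 * z6 + z7 * z7))%Z.
  by clear H lift; subst a b c d e f g z1; lia.
by rewrite Ez Z.mul_comm Z_mod_mult.
Qed.

(* [m1] is nonzero mod 7 after exchanging two coordinates that differ mod 7, if it was zero before. *)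
Definition swap7 (w : vec7) : vec7 :=
  let: (a, (b, (c, (d, (e, (f, g)))))) := w in
  if ~~ cg a b then (b, (a, (c, (d, (e, (f, g))))))
  else if ~~ cg c d then (a, (b, (d, (c, (e, (f, g))))))
  else if ~~ cg e f then (a, (b, (c, (d, (f, (e, g))))))
  else (c, (d, (a, (b, (e, (f, g)))))).

Lemma cgC x y : cg x y = cg y x.
Proof. rewrite /cg; lia. Qed.

Lemma swap7K : involutive swap7.
Proof.
move=> w; vec7 w a b c d e f g; rewrite /swap7.
case Hab: (cg a b) => /=; last by rewrite cgC Hab.
case Hcd: (cg c d) => /=; last by rewrite Hab /= cgC Hcd.
case Hef: (cg e f) => /=; last by rewrite Hab /= Hcd /= cgC Hef.
by rewrite Hcd /= Hab /= Hef.
Qed.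

Lemma swap7w (w : vec7) : gw (g := G7) (swap7 w) = gw (g := G7) w.
Proof.
apply: eqG7w; vec7 w a b c d e f g; rewrite /swap7.
by do 3?case: ifP => _; rewrite !G7w; lia.
Qed.

(** The lattice that receives [dcls _ 0 0] after division by 7. *)
Definition lat7 (w : vec7) := (sum7 w =? 0)%Z && (m1 w mod 7 =? 0)%Z.

Lemma swap7_lat w : lat7 w -> ~~ const7 w ->
  (sum7 (swap7 w) = 0 /\ m1 (swap7 w) mod 7 <> 0)%Z.
Proof.
vec7 w a b c d e f g; rewrite /lat7 /const7 /swap7 /sum7 /m1 /cg => H Hc.
case: ifP => Hab; first by split; clear Hc; lia.
case: ifP => Hcd; first by split; clear Hc; lia.
case: ifP => Hef; first by split; clear Hc; lia.
(* Here a = b, c = d and e = f modulo 7, so the double exchange changes [m1] by 4 (a - c); if a = c,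
   the two conditions of [lat7] make all coordinates congruent. *)
split; first by clear Hc; lia.
move=> E; have Hac : ((a - c) mod 7 = 0)%Z by clear Hc; lia.
have Hce : ((c - e) mod 7 = 0)%Z by clear Hc; lia.
by case/negP: Hc; repeat (apply/andP; split); lia.
Qed.

(** After the exchange [m1] has one of six nonzero residues u; multiplication by 7 sends the vector
    into [dcls (49 * n) 0 u], which the reflection bounds. *)
Lemma lat7_nonconst_le n :
  (gcount (G := G7) [pred w | lat7 w && ~~ const7 w] n <= 6 * ccls (49 * n) 1 0)%N.
Proof.
apply: leq_trans (_ : (gcount (G := G7) [pred w | (sum7 w =? 0)%Z && ~~ (m1 w mod 7 =? 0)%Z] n <= _)%N).
  apply: (gcount_le (G := G7) (H := G7) (f := swap7)) => [w /= /andP[Hl Hc] Ew|w w' _ _ _ _ E].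
    split; last by rewrite -Ew; exact: swap7w.
    by have [-> H] := swap7_lat Hl Hc; apply/andP; split=> //; apply/negP => /Z.eqb_eq.
  by rewrite -(swap7K w) E swap7K.
rewrite (gcount_partition (G := G7) (k := 7) (f := fun w => mres (m1 w))) => [|w _];
  last exact: mres_lt.
rewrite big_ord_recl gcount0 ?add0n; last first.
  by move=> w _ /=; rewrite /mres; move: (m1 w) (sum7 w) => x y; lia.
apply: leq_trans (_ : (\sum_(i < 6) ccls (49 * n) 1 0 <= _)%N); last by rewrite sum_nat_const card_ord.
apply: leq_sum => i _.
apply: leq_trans (_ : (dcls (49 * n) 0 (Z.of_nat (lift ord0 i)) <= _)%N); last first.
  by apply: dcls_le; rewrite /cg lift0; have := ltn_ord i; lia.
apply: (gcount_le (G := G7) (H := G7) (f := fun w : vec7 =>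
  let: (a, (b, (c, (d, (e, (f, g)))))) := w in
  ((7 * a)%Z, ((7 * b)%Z, ((7 * c)%Z, ((7 * d)%Z, ((7 * e)%Z, ((7 * f)%Z, (7 * g)%Z)))))) : vec7)).
- move=> w Hw Ew; split; last first.
    move: Hw Ew; vec7 w a b c d e f g => _ Ew; apply: Nat2Z.inj; rewrite Nat2Z.inj_mul -Ew !G7w; lia.
  move: Hw; rewrite /= mresE; last by rewrite ltnS.
  move: (Z.of_nat (lift ord0 i)) => u.
  by clear Ew; vec7 w a b c d e f g; rewrite /sum7 /m1 /cls /cg; lia.
- move=> w w' _ _ _ _; vec7 w a b c d e f g; vec7 w' a' b' c' d' e' f' g'.
  by case=> *; repeat congr pair; lia.
Qed.

Lemma const7_norm n : (0 < gcount (G := G7) [pred w | lat7 w && const7 w] (2 * n))%N ->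
  (7 %| n)%N.
Proof.
rewrite -has_count => /hasP[w]; rewrite mem_gfib => /eqP Ew.
have := congr1 Z.of_nat Ew; clear Ew; vec7 w a b c d e f g; rewrite G7w /= /const7 /cg => E H.
have lift x : ((x - d) mod 7 = 0 -> exists z, x = d + 7 * z)%Z.
  by move=> Hx; exists ((x - d) / 7)%Z; lia.
have [z1 E1] := lift a ltac:(clear - H; lia); have [z2 E2] := lift b ltac:(clear - H; lia).
have [z3 E3] := lift c ltac:(clear - H; lia).
have [z5 E5] := lift e ltac:(clear - H; lia); have [z6 E6] := lift f ltac:(clear - H; lia).
have [z7 E7] := lift g ltac:(clear - H; lia).
have Ez : (2 * Z.of_nat n = 7 * (d * d + 7 * (z1 * z1 + z2 * z2 + z3 * z3 + z5 * z5 + z6 * z6 + z7 * z7)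
   + 2 * d * (z1 + z2 + z3 + z5 + z6 + z7)))%Z.
  by clear H lift; subst a b c e f g; lia.
have : (exists k, 2 * Z.of_nat n = 7 * k)%Z by eexists; exact: Ez.
by case=> k Ek; clear - Ek; lia.
Qed.

(** For coordinates t + s i, [m1] is congruent to s times the sum of the i^2, which is 28. *)
Lemma lam_lat7 w : lam w -> lat7 w.
Proof.
vec7 w a b c d e f g; rewrite /lam /lat7 /sum7 /m1 /cg; lia.
Qed.

Lemma const7_lam w : const7 w -> lam w.
Proof. vec7 w a b c d e f g; rewrite /lam /const7 /cg; lia. Qed.

Lemma dcls0_le n : (dcls (14 * (7 * n)) 0 0 <=
  gcount (G := G7) lat7 (2 * n))%N.
Proof.
apply: (gcount_le (G := G7) (H := G7) (f := fun w : vec7 =>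
  let: (a, (b, (c, (d, (e, (f, g)))))) := w in
  ((a / 7)%Z, ((b / 7)%Z, ((c / 7)%Z, ((d / 7)%Z, ((e / 7)%Z, ((f / 7)%Z, (g / 7)%Z)))))) : vec7)).
- move=> w /andP[Hw Hm] Ew; have := congr1 Z.of_nat Ew; move: {Ew} Hw Hm.
  vec7 w a b c d e f g; rewrite G7w /cls /cg /m1 => Hw Hm E.
  have lift x : ((x - 0) mod 7 = 0 -> exists z, x = 7 * z /\ x / 7 = z)%Z.
    by move=> Hx; exists (x / 7)%Z; lia.
  have [z1 [E1 ->]] := lift a ltac:(clear - Hw; lia); have [z2 [E2 ->]] := lift b ltac:(clear - Hw; lia).
  have [z3 [E3 ->]] := lift c ltac:(clear - Hw; lia); have [z4 [E4 ->]] := lift d ltac:(clear - Hw; lia).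
  have [z5 [E5 ->]] := lift e ltac:(clear - Hw; lia); have [z6 [E6 ->]] := lift f ltac:(clear - Hw; lia).
  have [z7 [E7 ->]] := lift g ltac:(clear - Hw; lia).
  clear lift; split.
    have Hs : (a + b + c + d + e + f + g = 0)%Z by clear - Hw; lia.
    by clear E Hw; subst a b c d e f g; rewrite /lat7 /sum7 /m1; lia.
  by apply: Nat2Z.inj; rewrite G7w; clear Hw Hm; subst a b c d e f g; lia.
- move=> w w' /andP[Hw _] /andP[Hw' _] _ _; move: Hw Hw'.
  vec7 w a b c d e f g; vec7 w' a' b' c' d' e' f' g'; rewrite /cls /cg => H H'.
  case=> e1 e2 e3 e4 e5 e6 e7.
  have div7 x : ((x - 0) mod 7 = 0 -> x = 7 * (x / 7))%Z by lia.
  have cong x y : ((x - 0) mod 7 = 0 -> (y - 0) mod 7 = 0 -> x / 7 = y / 7 -> x = y)%Z by lia.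
  by repeat congr pair; apply: cong => //; clear - H H'; lia.
Qed.

Lemma ccls_le_nonconst n :
  (42 * ccls n 1 0 <= gcount (G := G7) [pred w | lat7 w && ~~ const7 w] n)%N.
Proof.
have := clam_sum n; rewrite /clam (gcount_predID (G := G7) _ const7).
have -> : gcount (G := G7) [pred w | lam w && const7 w] n = cconst n.
  apply: eq_gcount => w _ /=; case: (boolP (const7 w)) => [/const7_lam -> //|_].
  by rewrite andbF.
rewrite addnC => /addIn <-; apply: gcount_sub => w _ /= /andP[/lam_lat7 -> //].
Qed.

(* The descent [n -> n / 49] comes from vectors all of whose coordinates are congruent mod 7. *)
Lemma cconst_le n : (0 < n)%N -> (cconst (14 * n) <= 14 * ccls (14 * n) 1 0)%N.
Proof.
elim/ltn_ind: n => n IH n0; rewrite cconst_sum.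
pose F (i : nat) := ccls (14 * n) 0 (Z.of_nat i).
set A := ccls (14 * n) 1 0.
have H0 i : (0 < i < 7)%N -> (F i <= 7 * A)%N.
  by move=> i0; apply: ccls0_le; rewrite /cg; lia.
have Hz i : ((2 * Z.of_nat n + Z.of_nat i * Z.of_nat i) mod 7 <> 0)%Z -> F i = 0%N.
  by move=> Hi; apply/eqP; rewrite -leqn0 leqNgt; apply/negP => /ccls0_norm.
have -> : (\sum_(i < 7) ccls (14 * n) 0 (Z.of_nat i) = \sum_(i < 7) F i)%N by [].
have [/dvdnP[m Em]|n7] := boolP (7 %| n)%N; last first.
  (* For n prime to 7, - 2 n has at most two square roots modulo 7, both nonzero, so at most two
     constant classes occur. *)
  have h1 := H0 1%N isT; have h2 := H0 2%N isT; have h3 := H0 3%N isT.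
  have h4 := H0 4%N isT; have h5 := H0 5%N isT; have h6 := H0 6%N isT.
  have z0 := Hz 0%N; have z1 := Hz 1%N; have z2 := Hz 2%N; have z3 := Hz 3%N.
  have z4 := Hz 4%N; have z5 := Hz 5%N; have z6 := Hz 6%N.
  rewrite !big_ord_recr big_ord0 /=.
  move: (F 0%N) (F 1%N) (F 2%N) (F 3%N) (F 4%N) (F 5%N) (F 6%N) h1 h2 h3 h4 h5 h6 z0 z1 z2 z3 z4 z5 z6.
  clear H0 Hz F IH; move: A => A x0 x1 x2 x3 x4 x5 x6 h1 h2 h3 h4 h5 h6 z0 z1 z2 z3 z4 z5 z6.
  have : (Z.of_nat n mod 7 = 1 \/ Z.of_nat n mod 7 = 2 \/ Z.of_nat n mod 7 = 3
    \/ Z.of_nat n mod 7 = 4 \/ Z.of_nat n mod 7 = 5 \/ Z.of_nat n mod 7 = 6)%Z.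
    by clear z0 z1 z2 z3 z4 z5 z6; lia.
  clear n7 n0 => Hn; have {z0} E0 := z0 ltac:(lia).
  have z1' : (Z.of_nat n mod 7 <> 3)%Z -> x1 = 0%N by move=> Hr; apply: z1; lia.
  have z6' : (Z.of_nat n mod 7 <> 3)%Z -> x6 = 0%N by move=> Hr; apply: z6; lia.
  have z2' : (Z.of_nat n mod 7 <> 5)%Z -> x2 = 0%N by move=> Hr; apply: z2; lia.
  have z5' : (Z.of_nat n mod 7 <> 5)%Z -> x5 = 0%N by move=> Hr; apply: z5; lia.
  have z3' : (Z.of_nat n mod 7 <> 6)%Z -> x3 = 0%N by move=> Hr; apply: z3; lia.
  have z4' : (Z.of_nat n mod 7 <> 6)%Z -> x4 = 0%N by move=> Hr; apply: z4; lia.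
  clear z1 z2 z3 z4 z5 z6; lia.
have F0 i : (0 < i < 7)%N -> F i = 0%N.
  move=> i0; apply: Hz; have : (i = 1 \/ i = 2 \/ i = 3 \/ i = 4 \/ i = 5 \/ i = 6)%N by lia.
  by case=> [|[|[|[|[]]]]] ->; lia.
have m0 : (0 < m)%N by lia.
rewrite big_ord_recl big1 ?addn0 => [|i _]; last first.
  by apply: F0; rewrite lift0; have := ltn_ord i; lia.
rewrite /F dcls_sum big_ord_recl.
have L6 : (\sum_(i < 6) dcls (14 * n) 0 (Z.of_nat (lift ord0 i)) <= 6 * A)%N.
  apply: leq_trans (_ : (\sum_(i < 6) A <= _)%N); last by rewrite sum_nat_const card_ord.
  by apply: leq_sum => i _; apply: dcls_le; rewrite /cg lift0; have := ltn_ord i; lia.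
have D0 : (dcls (14 * n) 0 0 <= gcount (G := G7) lat7 (2 * m))%N.
  by rewrite Em (mulnC m); apply: dcls0_le.
have NC := lat7_nonconst_le (2 * m).
rewrite (_ : (49 * (2 * m) = 14 * n)%N) -/A in NC; last by rewrite Em; lia.
rewrite (gcount_predID (G := G7) _ const7) in D0.
(* 14 = 6 + 6 + 2: the classes u <> 0, the nonconstant lattice vectors, and the constant ones. The
   last number at most 14 c', where c' is the value of [ccls] at 14 k and 42 c' <= 6 A. *)
suff : (gcount (G := G7) [pred w | lat7 w && const7 w] (2 * m) <= 2 * A)%N.
  move=> CC; apply: leq_trans (leq_add D0 L6) _.
  by apply: leq_trans (leq_add (leq_add CC NC) (leqnn _)) _; clear; lia.
have [->//|Hpos] := posnP (gcount (G := G7) [pred w | lat7 w && const7 w] (2 * m)).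
have /dvdnP[k Ek] := const7_norm Hpos.
have Em2 : (2 * m = 14 * k)%N by rewrite Ek; lia.
have IHk := IH k ltac:(lia) ltac:(lia).
have NC2 := ccls_le_nonconst (14 * k).
rewrite Em2 in NC *.
have : (gcount (G := G7) [pred w | lat7 w && const7 w] (14 * k) <= cconst (14 * k))%N.
  by apply: gcount_sub => w _ /= /andP[].
lia.
Qed.

(** * Triples of elements of O inside the progression classes *)

Definition G6 : gset := gprod G2 (gprod G2 G2).

Lemma G6w (z1 z2 z3 : Z * Z) : Z.of_nat (gw (g := G6) (z1, (z2, z3))) =
  (z1.1 * z1.1 + z2.1 * z2.1 + z3.1 * z3.1
   + 7 * (z1.2 * z1.2 + z2.2 * z2.2 + z3.2 * z3.2))%Z.
Proof.
have := G2w z1; have := G2w z2; have := G2w z3.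
change (gw (g := G6) (z1, (z2, z3))) with
  (gw (g := G2) z1 + (gw (g := G2) z2 + gw (g := G2) z3))%N.
by rewrite !Nat2Z.inj_add => -> -> ->; ring.
Qed.

(* 0 : norm exactly divisible by pi, 1 : by its conjugate, 2 : odd norm, 3 : multiple of 2,
   for (x + y sqrt(-7)) / 2 where 2 = pi * conj pi. *)
Definition ptype (z : Z * Z) : nat :=
  if isP z then 0 else if isQ z then 1 else if isO z then 2 else if isZ z then 3 else 4.

Lemma ptype0 z : (ptype z == 0%N) = isP z.
Proof. by rewrite /ptype; do 4?case: ifP. Qed.
Lemma ptype1 z : (ptype z == 1%N) = isQ z.
Proof.
rewrite /ptype; case HP: (isP z); last by do 3?case: ifP.
by move: HP; case: z => x y; rewrite /isP /isQ /=; lia.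
Qed.
Lemma ptype2 z : (ptype z == 2%N) = isO z.
Proof.
rewrite /ptype; case HP: (isP z); last (case HQ: (isQ z); last by do 2?case: ifP).
  by move: HP; case: z => x y; rewrite /isP /isO /=; lia.
by clear HP; move: HQ; case: z => x y; rewrite /isQ /isO /=; lia.
Qed.
Lemma ptype3 z : (ptype z == 3%N) = isZ z.
Proof.
case: z => x y; rewrite /ptype /isP /isQ /isO /isZ /=.
do 4?case: ifP; lia.
Qed.

Definition pcode (z : (Z * Z) * ((Z * Z) * (Z * Z))) : nat * (nat * nat) :=
  (ptype z.1, (ptype z.2.1, ptype z.2.2)).

(** Types 0, 1, 2, 3 vanish modulo pi only, conj pi only, neither, both. The eight codes say that
    the residues of the triple modulo pi form a word of the even-weight code of length 3, and those
    modulo conj pi a word of the repetition code; this makes [emb] integral. *)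
Definition pcodes : seq (nat * (nat * nat)) :=
  [:: (0, (0, 0)); (0, (2, 2)); (2, (0, 2)); (2, (2, 0));
      (3, (3, 3)); (3, (1, 1)); (1, (3, 1)); (1, (1, 3))]%N.

Lemma gcount_codes (G : gset) (T : eqType) (f : gT G -> T) (s : seq T) n : uniq s ->
  gcount [pred z | f z \in s] n = (\sum_(c <- s) gcount [pred z | f z == c] n)%N.
Proof.
elim: s => [|c s IH] /=; first by rewrite big_nil gcount0.
move=> /andP[cs us]; rewrite big_cons -IH // (gcount_predID _ [pred z | f z == c]).
congr (_ + _)%N; apply: eq_gcount => z _; rewrite !inE.
  by case: (f z == c); rewrite ?andbF.
by case: eqP => [->|_]; rewrite ?(negbTE cs) ?andbF ?andbT.
Qed.

Definition ptypes (k : nat) : series := gs (G := G2) [pred z | ptype z == k].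

Lemma gs_pcode i j k :
  gs (G := G6) [pred z | pcode z == (i, (j, k))] = ptypes i * (ptypes j * ptypes k).
Proof.
rewrite /ptypes -(gs_prod (G := G2) (H := G2)) -(gs_prod (G := G2) (H := gprod G2 G2)).
by apply: seriesP => n; rewrite !gsE; congr Posz; apply: eq_gcount.
Qed.

Lemma ptypesE k Q : (forall z, (ptype z == k) = Q z) -> ptypes k = gs (G := G2) Q.
Proof.
move=> H; apply: seriesP => n; rewrite !gsE; congr Posz.
by apply: eq_gcount => z _ /=; apply: H.
Qed.

Lemma gs_half (Q R : pred (Z * Z)) :
  (forall x y, Q (x, y) -> (x mod 2 = 0 /\ y mod 2 = 0)%Z) ->
  (forall x y, Q (2 * x, 2 * y)%Z = R (x, y)) ->
  gs (G := G2) Q = dil 3 (gs (G := G2) R).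
Proof.
move=> HQ HR; apply: seriesP => n; have [/dvdnP[m ->]|Hn] := boolP (4 %| n)%N; last first.
  rewrite dil_ndvd // gsE gcount0 // => -[x y]; change Z in x, y; move=> Hw.
  apply/negP => /HQ[Hx Hy]; have := G2w (x, y); rewrite Hw /= => E; case/negP: Hn.
  have [k Ek] : exists k, (x = 2 * k)%Z by exists (x / 2)%Z; clear - Hx; lia.
  have [l El] : exists l, (y = 2 * l)%Z by exists (y / 2)%Z; clear - Hy; lia.
  apply/dvdnP; exists (Z.to_nat (k * k + 7 * (l * l))); subst x y; nia.
rewrite mulnC dilE !gsE; congr Posz.
apply: (gcount_bij (G := G2) (H := G2) (f := fun z : Z * Z => (z.1 / 2, z.2 / 2)%Z : Z * Z)
  (g := fun z : Z * Z => (2 * z.1, 2 * z.2)%Z : Z * Z)).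
- case=> x y; change Z in x, y; move=> Hq Hw; have [Hx Hy] := HQ _ _ Hq.
  have := G2w (x, y); rewrite Hw /= => E.
  have [k Ek] : exists k, (x = 2 * k)%Z by exists (x / 2)%Z; clear - Hx; lia.
  have [l El] : exists l, (y = 2 * l)%Z by exists (y / 2)%Z; clear - Hy; lia.
  have -> : (x / 2 = k)%Z by clear - Ek; lia.
  have -> : (y / 2 = l)%Z by clear - El; lia.
  split; [by rewrite -HR -Ek -El | | by rewrite Ek El].
  by apply: Nat2Z.inj; rewrite (G2w (_, _)) /=; subst x y; clear - E; lia.
- case=> x y; change Z in x, y; move=> Hq Hw; have := G2w (x, y); rewrite Hw /= => E.
  split; [by rewrite HR | | by congr pair; clear; lia].
  by apply: Nat2Z.inj; rewrite (G2w (_, _)) /=; clear - E; lia.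
Qed.

Lemma ptypes0 : ptypes 0 = dil 7 (psi7 *+ 2).
Proof. by rewrite (ptypesE ptype0) gs_isP. Qed.
Lemma ptypes1 : ptypes 1 = dil 7 (psi7 *+ 2).
Proof. by rewrite (ptypesE ptype1) gs_isQ. Qed.

Lemma T_gs : theta_T = gs (G := G2) (fun z : Z * Z => (z.1 - z.2) mod 2 =? 0)%Z.
Proof.
rewrite /theta_T -!gs_G2; apply: seriesP => n; rewrite cfD !gsE -PoszD; congr Posz.
rewrite [RHS](gcount_predID (G := G2) _ (fun z : Z * Z => isev z.1)).
congr (_ + _)%N; apply: eq_gcount => -[x y]; change Z in x, y; move=> _;
  rewrite /= /isev; lia.
Qed.

Lemma ptypes3 : ptypes 3 = dil 7 theta.
Proof.
rewrite (ptypesE ptype3) -(dil_comp 3 1) -T_dil T_gs; apply: gs_half => x y; rewrite /isZ /=; lia.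
Qed.

Lemma ptypes2 : ptypes 2 = dil 3 (oddp *+ 2).
Proof.
rewrite (ptypesE ptype2) (@gs_half _ (fun z : Z * Z => ~~ ((z.1 - z.2) mod 2 =? 0))%Z).
- congr (dil 3 _); apply: (addrI theta_T); rewrite -Phi_split T_gs /Phi /phi -gs_G2.
  apply: seriesP => n; rewrite cfD !gsE -PoszD; congr Posz; apply/esym.
  rewrite (gcount_predID (G := G2) _ (fun z : Z * Z => (z.1 - z.2) mod 2 =? 0)%Z).
  by congr (_ + _)%N; apply: eq_gcount => -[x y].
- by move=> x y; rewrite /isO /=; lia.
- by move=> x y; rewrite /isO /=; lia.
Qed.

(** Type 0 three times gives 8 xi^3, type 0 with two of type 2 gives 3 * 8 xi^2 (theta - xi), type 3
    three times theta^3, and type 3 with two of type 1 gives 3 * 4 theta xi^2. *)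
Lemma gs_pcodes : gs (G := G6) [pred z | pcode z \in pcodes] = dil 7 Ys.
Proof.
have E2 : ptypes 2 ^+ 2 = dil 7 (psi7 * (theta - psi7) *+ 4).
  rewrite ptypes2 -dilX (_ : (oddp *+ 2) ^+ 2 = oddp ^+ 2 *+ 4); last by ring.
  by rewrite oddp_sqr_dil -dilMn dil_comp.
have Ep : ptypes 0 = dil 7 (psi7 *+ 2) by exact: ptypes0.
have -> : gs (G := G6) [pred z | pcode z \in pcodes] = ptypes 0 ^+ 3
  + ptypes 0 * ptypes 2 ^+ 2 *+ 3 + ptypes 3 ^+ 3 + ptypes 3 * ptypes 1 ^+ 2 *+ 3.
  transitivity (\sum_(c <- pcodes) gs (G := G6) [pred z | pcode z == c]).
    apply: seriesP => n; rewrite gsE (gcount_codes (G := G6)) //.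
    rewrite (big_morph Posz PoszD (erefl _)).
    rewrite (big_morph (fun f : series => f n) (fun f g => cfD f g n) (cf0 n)).
    by apply: eq_bigr.
  rewrite !big_cons big_nil !gs_pcode; ring.
rewrite E2 ptypes0 ptypes1 ptypes3 -!dilX -!dilM -!dilMn -!dilD; congr (dil 7 _).
rewrite /Ys /cub; ring.
Qed.

(* [(1/4) sum_i (x_i rho_i + 7 y_i kappa_i)], where the [rho_i] (norm 28) and the [kappa_i]
   (norm 4) are pairwise orthogonal. *)
Definition emb (z : (Z * Z) * ((Z * Z) * (Z * Z))) : vec7 :=
  let: ((x1, y1), ((x2, y2), (x3, y3))) := z in
  ((((- 3 * x1 - 7 * y1) + (- x3 + 7 * y3)) / 4)%Z,
  (((- 2 * x1 + 2 * x2 + 3 * x3 - 7 * y3) / 4)%Z,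
  (((- x1 + 7 * y1 - 3 * x2 - 7 * y2) / 4)%Z,
  (((- x2 + 7 * y2 - 3 * x3 - 7 * y3) / 4)%Z,
  (((x1 + 7 * y1 + x2 + 7 * y2 + x3 + 7 * y3) / 4)%Z,
  (((2 * x1 + 3 * x2 - 7 * y2 - 2 * x3) / 4)%Z,
   ((3 * x1 - 7 * y1 - 2 * x2 + 2 * x3) / 4)%Z)))))).

Lemma emb_spec x1 y1 x2 y2 x3 y3 : pcode ((x1, y1), ((x2, y2), (x3, y3))) \in pcodes ->
  exists a b c d e f g, [/\ emb ((x1, y1), ((x2, y2), (x3, y3))) = (a, (b, (c, (d, (e, (f, g)))))),
  4 * a = - 3 * x1 - 7 * y1 - x3 + 7 * y3,
  4 * b = - 2 * x1 + 2 * x2 + 3 * x3 - 7 * y3,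
  4 * c = - x1 + 7 * y1 - 3 * x2 - 7 * y2 &
  [/\ 4 * d = - x2 + 7 * y2 - 3 * x3 - 7 * y3,
  4 * e = x1 + 7 * y1 + x2 + 7 * y2 + x3 + 7 * y3,
  4 * f = 2 * x1 + 3 * x2 - 7 * y2 - 2 * x3 &
  4 * g = 3 * x1 - 7 * y1 - 2 * x2 + 2 * x3]]%Z.
Proof.
rewrite /pcodes !inE /pcode !xpair_eqE !ptype0 !ptype1 !ptype2 !ptype3 /=.
rewrite /isP /isQ /isO /isZ /= => H.
have Hmod : [/\ (- 3 * x1 - 7 * y1 - x3 + 7 * y3) mod 4 = 0,
  (- 2 * x1 + 2 * x2 + 3 * x3 - 7 * y3) mod 4 = 0,
  (- x1 + 7 * y1 - 3 * x2 - 7 * y2) mod 4 = 0 &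
  [/\ (- x2 + 7 * y2 - 3 * x3 - 7 * y3) mod 4 = 0,
  (x1 + 7 * y1 + x2 + 7 * y2 + x3 + 7 * y3) mod 4 = 0,
  (2 * x1 + 3 * x2 - 7 * y2 - 2 * x3) mod 4 = 0 &
  (3 * x1 - 7 * y1 - 2 * x2 + 2 * x3) mod 4 = 0]]%Z.
  by case/or4P: H => [H|H|H|/or4P[H|H|H|/orP[H|H]]]; (split; last split); lia.
case: Hmod => H1 H2 H3 [H4 H5 H6 H7]; clear H.
do 7!eexists; split; first by rewrite /emb.
- clear - H1; lia.
- clear - H2; lia.
- clear - H3; lia.
split; [clear - H4; lia | clear - H5; lia | clear - H6; lia | clear - H7; lia].
Qed.

(** By orthogonality 16 |w|^2 = 28 times the weight of the triple, and that weight is 8 n. *)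
Lemma Ys_le_clam n : Ys n <= (clam (14 * n))%:Z.
Proof.
rewrite -(dilE 7) -gs_pcodes gsE lez_nat.
apply: (gcount_le (G := G6) (H := G7) (f := emb)).
- case=> -[x1 y1] [[x2 y2] [x3 y3]]; change Z in x1, y1, x2, y2, x3, y3.
  move=> Hz Hw; have := congr1 Z.of_nat Hw; rewrite G6w [_.1]/= [_.2]/=; clear Hw.
  have [a [b [c [d [e [f [g [-> Ea Eb Ec [Ed Ee Ef Eg]]]]]]]]] := emb_spec Hz; clear Hz.
  move=> /= E; split.
    rewrite /lam /cg; clear E; repeat (apply/andP; split); lia.
  apply: Nat2Z.inj; rewrite (G7w a b c d e f g).
  have : (16 * (a * a + b * b + c * c + d * d + e * e + f * f + g * g) =
    28 * (x1 * x1 + x2 * x2 + x3 * x3 + 7 * (y1 * y1 + y2 * y2 + y3 * y3)))%Z.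
    transitivity ((4 * a) * (4 * a) + (4 * b) * (4 * b) + (4 * c) * (4 * c) + (4 * d) * (4 * d)
      + (4 * e) * (4 * e) + (4 * f) * (4 * f) + (4 * g) * (4 * g))%Z; first by ring.
    by rewrite Ea Eb Ec Ed Ee Ef Eg; ring.
  clear - E; move: E; rewrite !Nat2Z.inj_mul; lia.
- case=> -[x1 y1] [[x2 y2] [x3 y3]]; change Z in x1, y1, x2, y2, x3, y3.
  case=> -[x1' y1'] [[x2' y2'] [x3' y3']]; change Z in x1', y1', x2', y2', x3', y3'.
  move=> Hz Hz' _ _.
  have [a [b [c [d [e [f [g [-> Ea Eb Ec [Ed Ee Ef Eg]]]]]]]]] := emb_spec Hz; clear Hz.
  have [a' [b' [c' [d' [e' [f' [g' [-> Ea' Eb' Ec' [Ed' Ee' Ef' Eg']]]]]]]]] := emb_spec Hz'; clear Hz'.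
  case=> *; subst a' b' c' d' e' f' g'.
  repeat congr pair; lia.
Qed.

(** * Finite Jacobi triple product *)

Section QBinomial.
Variables (R : comNzRingType) (Q : R).

Fixpoint gb (n k : nat) : R :=
  match n, k with
  | _, O => 1
  | O, S _ => 0
  | S n', S k' => gb n' k + Q ^+ (n' - k') * gb n' k'
  end.

Arguments gb : simpl never.

Lemma gbn0 n : gb n 0 = 1. Proof. by case: n. Qed.
Lemma gbSS n k : gb n.+1 k.+1 = gb n k.+1 + Q ^+ (n - k) * gb n k.
Proof. by []. Qed.
Lemma gb_small n k : (n < k)%N -> gb n k = 0.
Proof.
elim: n k => [|n IH] [|k] //; rewrite ltnS => lt_nk.
by rewrite gbSS !IH ?mulr0 ?addr0 // ltnW.
Qed.
Lemma gbnn n : gb n n = 1.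
Proof. by elim: n => // n IH; rewrite gbSS gb_small // IH subnn mulr1 add0r. Qed.

Lemma gbSS' n k : gb n.+1 k.+1 = gb n k + Q ^+ k.+1 * gb n k.+1.
Proof.
elim: n k => [|n IH] k.
  by rewrite gbSS /=; case: k => [|k]; rewrite /= ?expr0 ?mulr0 ?mul1r ?addr0 ?add0r ?mulr1.
have [lt_kn|] := ltnP k n.+1; last first.
  rewrite leq_eqVlt => /predU1P[<-|lt_nk].
    by rewrite !gbnn gb_small // mulr0 addr0.
  by rewrite !gb_small ?mulr0 ?addr0 // ltnW.
rewrite [LHS]gbSS [in LHS]IH; case: k lt_kn => [|k] lt_kn.
  by rewrite subn0 !gbn0 gbSS gbn0 subn0 expr1 mulrDr !mulr1 -exprS addrA.
rewrite [X in _ + _ * X]IH [gb n.+1 k.+1 in RHS]gbSS [gb n.+1 k.+2 in RHS]gbSS subSS.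
have E : Q ^+ (n - k) * Q ^+ k.+1 = Q ^+ k.+2 * Q ^+ (n - k.+1) :> R.
  by rewrite -!exprD; congr (_ ^+ _); lia.
move: (gb n k) (gb n k.+1) (gb n k.+2) => x y z.
rewrite !mulrDr !mulrA -E; ring.
Qed.

Lemma gb_step n k : gb n k.+1 * (1 - Q ^+ k.+1) = gb n k * (1 - Q ^+ (n - k)).
Proof.
have := gbSS' n k; rewrite gbSS => E.
have : gb n k.+1 + Q ^+ (n - k) * gb n k - (gb n k + Q ^+ k.+1 * gb n k.+1) = 0.
  by rewrite E subrr.
move=> E0; apply/eqP; rewrite -subr_eq0 -E0; apply/eqP; ring.
Qed.

(** Cross-multiplied because R is an arbitrary commutative ring; the step equates the two Pascal
    rules. *)
Lemma gb_prod n k : 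
  gb n k * \prod_(i < k) (1 - Q ^+ i.+1) = \prod_(i < k) (1 - Q ^+ (n - i)).
Proof.
elim: k => [|k IH]; first by rewrite !big_ord0 gbn0 mulr1.
rewrite !big_ord_recr /= -IH [RHS]mulrAC -gb_step; ring.
Qed.

Variables (a b : R).
Hypothesis ab : a * b = Q.

(* The coefficient of z^s, without its Gaussian binomial factor. *)
Definition jex (m s : nat) : R :=
  if (m <= s)%N then a ^+ (s - m) * Q ^+ 'C(s - m, 2)
  else b ^+ (m - s) * Q ^+ 'C(m - s, 2).

Arguments jex : simpl never.

(** The finite triple product in z = ['X]; the factors 1 + b Q^j / z are multiplied by z to stay
    within polynomials, which moves the exponent 0 to [m2]. *)
Definition jprod (m1 m2 : nat) : {poly R} :=
  (\prod_(j < m1) (1 + (a * Q ^+ j) *: 'X)) * \prod_(j < m2) ('X + (b * Q ^+ j)%:P).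

Lemma jexS m s M : (m <= M)%N -> (s <= M)%N ->
  jex m s.+1 * Q ^+ (M - s) = a * Q ^+ (M - m) * jex m s.
Proof.
move=> mM sM; rewrite /jex; have [le_ms|lt_sm] := leqP m s.
  rewrite (leq_trans le_ms (leqnSn s)) subSn // binS bin1 exprS exprD.
  have E : Q ^+ (s - m) * Q ^+ (M - s) = Q ^+ (M - m) :> R.
    by rewrite -exprD; congr (_ ^+ _); lia.
  rewrite -E; ring.
have [Hs|Hs] := leqP m (s.+1)%N.
  have -> : m = (s.+1)%N by lia.
  rewrite subnn subSnn (@bin_small 0 2) // (@bin_small 1 2) // !expr0 expr1 !mul1r mulr1.
  have -> : (M - s = (M - s.+1).+1)%N by lia.
  by rewrite exprS -ab /=; ring.
have -> : (m - s = (m - s.+1).+1)%N by lia.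
rewrite binS bin1; have E : Q ^+ (M - s) = Q * (Q ^+ (M - m) * Q ^+ (m - s.+1)) :> R.
  by rewrite -exprD -exprS; congr (_ ^+ _); lia.
rewrite E exprS exprD.
by transitivity (b ^+ (m - s.+1) * Q ^+ 'C(m - s.+1, 2)
  * (a * b * (Q ^+ (M - m) * Q ^+ (m - s.+1)))); [rewrite ab; ring | ring].
Qed.

Lemma jexSS m s : jex m.+1 s.+1 = jex m s.
Proof. by rewrite /jex ltnS !subSS. Qed.

Lemma jex_prev m s : jex m s * (b * Q ^+ m) = jex m.+1 s * Q ^+ s.
Proof.
rewrite /jex; have [le_ms|lt_sm] := leqP m s.
  case: (ltnP m s) => Hs.
    have -> : (s - m = (s - m.+1).+1)%N by lia.
    rewrite binS bin1.
    have E : Q * (Q ^+ m * Q ^+ (s - m.+1)) = Q ^+ s :> R.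
      by rewrite -exprD -exprS; congr (_ ^+ _); lia.
    rewrite -E exprS exprD.
    by transitivity (a ^+ (s - m.+1) * Q ^+ 'C(s - m.+1, 2)
      * (a * b * (Q ^+ m * Q ^+ (s - m.+1)))); [ring | rewrite ab; ring].
  have -> : s = m by lia.
  by rewrite subnn subSnn (@bin_small 0 2) // (@bin_small 1 2) // !expr0 expr1 !mul1r mulr1.
rewrite ltnNge ltnW //= subSn; last exact: ltnW.
rewrite binS bin1 exprS exprD.
have E : Q ^+ m = Q ^+ (m - s) * Q ^+ s :> R by rewrite -exprD subnK // ltnW.
by rewrite E; ring.
Qed.

Lemma coef_jprod m1 m2 s : (jprod m1 m2)`_s = jex m2 s * gb (m1 + m2) s.
Proof.
elim: m1 s => [|m1 IH] s.
  elim: m2 s => [|m2 IH] s.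
    rewrite /jprod !big_ord0 mulr1 coef1; case: s => [|s].
      by rewrite /jex /= subnn bin0n expr0 mul1r gbn0 mulr1.
    by rewrite gb_small ?mulr0.
  rewrite /jprod big_ord_recr /= mulrA -/(jprod 0 m2) mulrDr coefD coefMX coefMC IH add0n.
  case: s => [|s]; rewrite ?add0r /=.
    by rewrite IH !gbn0 !mulr1 jex_prev expr0 mulr1.
  rewrite IH !add0n gbSS' [X in _ + X]mulrAC jex_prev !jexSS; ring.
rewrite /jprod big_ord_recr /= mulrAC -/(jprod m1 m2) mulrDr mulr1 coefD.
rewrite -scalerAr coefZ coefMX IH addSn; case: s => [|s] /=.
  by rewrite mulr0 addr0 !gbn0.
rewrite IH gbSS mulrDr; congr (_ + _).
have [le_s|lt_s] := leqP s (m1 + m2); last by rewrite gb_small // !mulr0.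
by rewrite !mulrA (@jexS m2 s (m1 + m2)) ?leq_addl // addnK.
Qed.

Lemma size_jprod m1 m2 : (size (jprod m1 m2) <= (m1 + m2).+1)%N.
Proof.
apply/leq_sizeP => s Hs; rewrite coef_jprod gb_small ?mulr0 //.
Qed.
End QBinomial.

(** * Seven-cores *)

Definition eqto (n : nat) (f g : series) := forall i, (i <= n)%N -> f i = g i.

Lemma eqto_mul n f g f' g' : eqto n f f' -> eqto n g g' -> eqto n (f * g) (f' * g').
Proof.
move=> Hf Hg i le_in; rewrite !cfM; apply: eq_bigr => j _.
have le_jn : (j <= n)%N by apply: leq_trans le_in; rewrite -ltnS.
by rewrite Hf // Hg // (leq_trans (leq_subr _ _) le_in).
Qed.
Lemma eqto_sum (I : Type) (r : seq I) (P : pred I) n (F G : I -> series) :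
  (forall i, P i -> eqto n (F i) (G i)) ->
  eqto n (\sum_(i <- r | P i) F i) (\sum_(i <- r | P i) G i).
Proof.
move=> H i le_in; elim/big_ind2: _ => [//|f g f' g' Ef Eg|j Pj].
  by rewrite !cfD Ef Eg.
exact: H.
Qed.
Lemma eqto_prod (I : Type) (r : seq I) (P : pred I) n (F G : I -> series) :
  (forall i, P i -> eqto n (F i) (G i)) ->
  eqto n (\prod_(i <- r | P i) F i) (\prod_(i <- r | P i) G i).
Proof.
move=> H; elim/big_ind2: _ => [//|f g f' g' Ef Eg|j Pj]; [exact: eqto_mul | exact: H].
Qed.
Lemma eqto_prod1 (I : Type) (r : seq I) (P : pred I) n (F : I -> series) :
  (forall i, P i -> eqto n (F i) 1) -> eqto n (\prod_(i <- r | P i) F i) 1.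
Proof.
move=> H; rewrite -[X in eqto n _ X](@big1_eq series 1 *%R I r P); exact: eqto_prod.
Qed.
Lemma eqto_dil n k f g : eqto n f g -> eqto n (dil k f) (dil k g).
Proof.
move=> H i le_in /=; case: ifP => // _; apply: H.
exact: leq_trans (leq_div _ _) le_in.
Qed.
Lemma eqto_sym n f g : eqto n f g -> eqto n g f.
Proof. by move=> H i le_in; rewrite H. Qed.
Lemma eqto_trans n f g h : eqto n f g -> eqto n g h -> eqto n f h.
Proof. by move=> H1 H2 i le_in; rewrite H1 // H2. Qed.

Lemma cf_sXn k n : (sX ^+ k) n = (n == k)%:R.
Proof.
elim: k n => [|k IH] n; first by rewrite cf1.
by rewrite exprS; case: n => [|n]; rewrite ?sXM_0 // sXM_S IH eqSS.
Qed.

Lemma eqto_sXn0 n k f : (n < k)%N -> eqto n (sX ^+ k * f) 0.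
Proof.
move=> lt_nk i le_in; rewrite cfM big1 // => j _; rewrite cf_sXn.
case: eqP => [Ej|]; last by rewrite mul0r.
by have := ltn_ord j; rewrite Ej; lia.
Qed.

Lemma eqto_1sub n k : (n < k)%N -> eqto n (1 - sX ^+ k) 1.
Proof.
move=> lt_nk i le_in; rewrite cfD cfN cf_sXn ltn_eqF ?oppr0 ?addr0 //.
exact: leq_ltn_trans lt_nk.
Qed.

Definition ofp (u : {poly int}) : series := Series (fun n => u`_n).

Lemma ofpM u v : ofp (u * v) = ofp u * ofp v.
Proof. by apply: seriesP => n; rewrite cfM /= coefM. Qed.
Lemma ofp1 : ofp 1 = 1.
Proof. by apply: seriesP => n; rewrite cf1 /= coef1. Qed.
Lemma ofp_1sub k : ofp (1 - 'X^k) = 1 - sX ^+ k.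
Proof. by apply: seriesP => n; rewrite cfD cfN cf_sXn cf1 /= coefB coef1 coefXn. Qed.

Definition Eser : series := Series qE.

Definition poch (Q : series) (k : nat) : series := \prod_(i < k) (1 - Q ^+ i.+1).

Lemma Eser_poch n k : (n <= k)%N -> eqto n Eser (poch sX k).
Proof.
move=> le_nk i le_in; rewrite /= (qEE (leq_trans le_in le_nk)).
rewrite -[LHS]/(ofp (\prod_(1 <= j < k.+1) (1 - 'X^j)) i); congr (cf _ i).
rewrite (big_morph ofp ofpM ofp1) /poch big_add1 big_mkord.
by apply: eq_bigr => j _; rewrite ofp_1sub.
Qed.

Lemma dil_sX k : dil k sX = sX ^+ k.+1.
Proof.
apply: seriesP => n; rewrite cf_sXn; have [/dvdnP[m ->]|Hn] := boolP (k.+1 %| n)%N.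
  have -> : (m * k.+1 == k.+1)%N = (m == 1)%N by rewrite -{2}[(k.+1)%N]mul1n eqn_pmul2r.
  by rewrite mulnC dilE -[X in cf X m](expr1 sX) cf_sXn.
rewrite dil_ndvd //; case: (altP (n =P (k.+1)%N)) => // E; by rewrite E dvdnn in Hn.
Qed.

Lemma dilE_poch d n k : (n <= k)%N -> eqto n (dil d Eser) (poch (sX ^+ d.+1) k).
Proof.
move=> le_nk; have := eqto_dil d (Eser_poch le_nk); rewrite rmorph_prod /poch.
rewrite (eq_bigr (fun i : 'I_k => 1 - sX ^+ d.+1 ^+ i.+1)) // => i _.
by rewrite rmorphB rmorph1 rmorphXn /= dil_sX.
Qed.

(** In the product formula every numerator factor 1 - Q^(n - i) is 1 up to order N, and the
    denominator is E(Q) up to that order. *)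
Lemma gb_dilE d N n k : (N <= k)%N -> (N + k <= n)%N ->
  eqto N (gb (sX ^+ d.+1) n k * dil d Eser) 1.
Proof.
move=> le_Nk le_n.
apply: eqto_trans (_ : eqto N (gb (sX ^+ d.+1) n k * poch (sX ^+ d.+1) k) _).
  by apply: eqto_mul => //; exact: dilE_poch.
rewrite /poch gb_prod //; apply: eqto_prod1 => i _; rewrite -exprM; apply: eqto_1sub.
have := ltn_ord i; nia.
Qed.

Lemma gb_Eser N n k : (N <= k)%N -> (N + k <= n)%N -> eqto N (gb sX n k * Eser) 1.
Proof.
move=> le_Nk le_n; have := @gb_dilE 0 N n k le_Nk le_n; rewrite expr1.
suff -> : dil 0 Eser = Eser by [].
by apply: seriesP => i; rewrite -{1}[i]mul1n dilE.
Qed.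

Lemma prod_blocks (R : comNzRingType) (F : nat -> R) d m :
  \prod_(i < d * m) F i = \prod_(r < d) \prod_(j < m) F (d * j + r)%N.
Proof.
elim: m => [|m IH].
  by rewrite muln0 big_ord0 big1 // => r _; rewrite big_ord0.
rewrite mulnSr big_split_ord /= IH -big_split /=.
by apply: eq_bigr => r _; rewrite big_ord_recr.
Qed.

Lemma jprod_blocks m : jprod sX 1 sX (7 * m) (7 * m) =
  \prod_(r < 7) jprod (sX ^+ 7) (sX ^+ r) (sX ^+ (7 - r)) m m.
Proof.
rewrite /jprod big_split /=; congr (_ * _).
  rewrite (prod_blocks (fun j => 1 + (1 * sX ^+ j) *: 'X)).
  apply: eq_bigr => r _; apply: eq_bigr => j _.
  by rewrite mul1r -exprM -exprD addnC.
rewrite (prod_blocks (fun j => 'X + (sX * sX ^+ j)%:P)).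
rewrite (reindex_inj rev_ord_inj) /=; apply: eq_bigr => r _; apply: eq_bigr => j _.
rewrite -exprM -exprD -exprS; congr ('X + (_ ^+ _)%:P).
have := ltn_ord r; lia.
Qed.

Lemma poly_sum_coef (R : nzRingType) (u : {poly R}) n : (size u <= n)%N ->
  u = \sum_(i < n) u`_i *: 'X^i.
Proof.
move=> le_un; apply/polyP => i; rewrite -(poly_def n (fun i => u`_i)) coef_poly.
by case: ltnP => // le_ni; rewrite nth_default // (leq_trans le_un).
Qed.

Definition jdeg (m r s : nat) : nat :=
  if (m <= s)%N then (r * (s - m) + 7 * 'C(s - m, 2))%N
  else ((7 - r) * (m - s) + 7 * 'C(m - s, 2))%N.

Lemma jex_jdeg m r s :
  jex (sX ^+ 7) (sX ^+ r) (sX ^+ (7 - r)) m s = sX ^+ jdeg m r s.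
Proof. by rewrite /jex /jdeg; case: ifP => _; rewrite -!exprM -exprD. Qed.

(** Two expansions of the coefficient of z^(7m) in the triple product with a = 1 and b = Q = q:
    directly, and after sorting the factors by the residue of their exponent modulo 7, which gives
    seven triple products with Q = q^7. *)
Lemma core_identity m :
  gb sX (7 * m + 7 * m) (7 * m) =
  \sum_(f : {ffun 'I_7 -> 'I_(m + m).+1} | (\sum_(r < 7) f r == 7 * m)%N)
    \prod_(r < 7) (sX ^+ jdeg m r (f r) * gb (sX ^+ 7) (m + m) (f r)).
Proof.
have := congr1 (fun u : {poly series} => u`_(7 * m)) (jprod_blocks m).
rewrite coef_jprod; last by rewrite mul1r.
rewrite /jex leqnn subnn expr0 mul1r (@bin_small 0 2) // expr0 mul1r => ->.
have H (r : 'I_7) : jprod (sX ^+ 7) (sX ^+ r) (sX ^+ (7 - r)) m m =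
  \sum_(s < (m + m).+1) (sX ^+ jdeg m r s * gb (sX ^+ 7) (m + m) s) *: 'X^s.
  have Er : sX ^+ r * sX ^+ (7 - r) = sX ^+ 7 by rewrite -exprD subnKC // ltnW.
  rewrite (poly_sum_coef (size_jprod Er m m)); apply: eq_bigr => s _.
  by rewrite (coef_jprod Er) jex_jdeg.
rewrite (eq_bigr _ (fun r _ => H r)) bigA_distr_bigA coef_sum [RHS]big_mkcond /=.
apply: eq_bigr => f _; rewrite scaler_prod coefZ.
rewrite -(big_morph (fun n => 'X^n) (exprD 'X) (expr0 'X)) coefXn eq_sym.
by case: eqP => _; rewrite ?mulr1 ?mulr0.
Qed.

Lemma jdeg_lower m r s : (r < 7)%N -> (m <= s + (jdeg m r s).+1)%N /\ (s <= m + (jdeg m r s).+1)%N.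
Proof.
move=> r7; rewrite /jdeg; have H k : (k <= 'C(k, 2) + 1)%N.
  case: k => [|[|k]] //; rewrite binS bin1; lia.
case: (leqP m s) => Hs.
  move: (H (s - m)%N) => {H}; move: ('C(s - m, 2))%N (r * (s - m))%N => c x H; split; lia.
move: (H (m - s)%N) => {H}; move: ('C(m - s, 2))%N ((7 - r) * (m - s))%N => c x H; split; lia.
Qed.

(** Up to order n each Gaussian binomial is the inverse of an Euler product. On the right this is
    needed only for terms of degree at most n, and by [jdeg_lower] their indices [f r] are close
    enough to the middle m. *)
Lemma core_eqto n m : (2 * n + 2 <= m)%N -> eqto n ((dil 6 Eser) ^+ 7)
  (Eser * \sum_(f : {ffun 'I_7 -> 'I_(m + m).+1} | (\sum_(r < 7) f r == 7 * m)%N)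
     sX ^+ (\sum_(r < 7) jdeg m r (f r))).
Proof.
move=> le_m; apply: eqto_trans (_ : eqto n (gb sX (7 * m + 7 * m) (7 * m) * Eser * dil 6 Eser ^+ 7) _).
  rewrite -[X in eqto _ X _]mul1r; apply: eqto_mul => //.
  by apply: eqto_sym; apply: gb_Eser; lia.
rewrite core_identity mulrAC mulrC; apply: eqto_mul => //.
rewrite mulr_suml; apply: eqto_sum => f _.
have -> : (\prod_(r < 7) (sX ^+ jdeg m r (f r) * gb (sX ^+ 7) (m + m) (f r))) * dil 6 Eser ^+ 7
  = sX ^+ (\sum_(r < 7) jdeg m r (f r)) * \prod_(r < 7) (gb (sX ^+ 7) (m + m) (f r) * dil 6 Eser).
  rewrite !big_split /= -(big_morph (fun k => sX ^+ k) (exprD sX) (expr0 sX)).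
  by rewrite prodr_const card_ord -mulrA.
have [lt_n|le_n] := ltnP n (\sum_(r < 7) jdeg m r (f r))%N.
  rewrite -[X in eqto _ _ X]mulr1.
  apply: eqto_trans (eqto_sXn0 _ lt_n) _; apply: eqto_sym; exact: eqto_sXn0.
rewrite -[X in eqto _ _ X]mulr1; apply: eqto_mul => //.
apply: eqto_prod1 => r _.
have [] := @jdeg_lower m r (f r) (ltn_ord r).
have : (jdeg m r (f r) <= n)%N.
  by apply: leq_trans le_n; rewrite (bigD1 r) //= leq_addr.
by move=> H1 H2 H3; apply: gb_dilE; lia.
Qed.

Definition Xser : series := Series (fps_div (fps_exp (fps_dilate 7 qE) 7) qE).

Lemma fps_exp_series f k : Series (fps_exp f k) = (Series f) ^+ k.
Proof.
elim: k => [|k IH]; first by apply: seriesP.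
by rewrite exprS -IH.
Qed.

Lemma fps_dilate_series f k : Series (fps_dilate k.+1 f) = dil k (Series f).
Proof. by []. Qed.

Lemma Xser_E : Xser = dil 6 Eser ^+ 7 * Series (fps_inv qE).
Proof.
rewrite -fps_dilate_series -fps_exp_series; by apply: seriesP.
Qed.

Lemma Eser_inv : Eser * Series (fps_inv qE) = 1.
Proof.
apply: seriesP => n; have := @fps_mulV qE; rewrite qE0 unitr1 => /(_ isT n) H.
by rewrite -[LHS]/(fps_mul qE (fps_inv qE) n) H.
Qed.

Lemma Xser_count n m : (2 * n + 2 <= m)%N -> Xser n =
  #|[pred f : {ffun 'I_7 -> 'I_(m + m).+1} | (\sum_(r < 7) f r == 7 * m)%N &&
     (\sum_(r < 7) jdeg m r (f r) == n)%N]|%:Z.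
Proof.
move=> le_m; have := eqto_mul (core_eqto le_m) (fun i _ => erefl (Series (fps_inv qE) i)).
rewrite -Xser_E mulrAC Eser_inv mul1r => /(_ n (leqnn n)) ->.
rewrite (big_morph (fun f : series => f n) (fun f g => cfD f g n) (cf0 n)).
rewrite -sum1_card (big_morph Posz PoszD (erefl _)) /= [RHS]big_mkcondr /=.
by apply: eq_bigr => f _; rewrite cf_sXn eq_sym; case: eqP.
Qed.

(** * From vectors to the exponents of the triple products *)

Definition wz (w : vec7) (r : nat) : Z :=
  let: (a, (b, (c, (d, (e, (f, g)))))) := w in nth 0%Z [:: a; b; c; d; e; f; g] r.
Definition kz (w : vec7) (r : nat) : Z := ((wz w r + 3 - Z.of_nat r) / 7)%Z.
Definition core (m : nat) (w : vec7) : {ffun 'I_7 -> 'I_(m + m).+1} :=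
  [ffun r : 'I_7 => inord (Z.to_nat (kz w r + Z.of_nat m))].

Lemma wz_le w r : (Z.abs (wz w r) <= Z.of_nat (gw (g := G7) w))%Z.
Proof.
vec7 w a b c d e f g; rewrite G7w /wz.
have H x : (0 <= Z.abs x <= x * x)%Z by nia.
have := H a; have := H b; have := H c; have := H d; have := H e; have := H f; have := H g.
move: (a * a)%Z (b * b)%Z (c * c)%Z (d * d)%Z (e * e)%Z (f * f)%Z (g * g)%Z => {H}.
by do 7?[case: r => [|r] /=; first by lia]; rewrite nth_nil; lia.
Qed.

Lemma coreE m w (r : 'I_7) : (gw (g := G7) w + 2 <= m)%N ->
  Z.of_nat (core m w r) = (kz w r + Z.of_nat m)%Z.
Proof.
move=> Hm; have Hw := @wz_le w r; have Hr := ltn_ord r.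
by rewrite ffunE inordK; rewrite /kz; lia.
Qed.

Lemma wzE w r : cls 1 0 w -> (r < 7)%N -> wz w r = (7 * kz w r + Z.of_nat r - 3)%Z.
Proof.
vec7 w a b c d e f g; rewrite /kz /wz /cls /cg => H.
by do 7?[case: r => [|r] /=; first by clear -H; lia].
Qed.

Lemma jdegE m r s : (r <= 7)%N -> (2 * Z.of_nat (jdeg m r s) =
  let k := Z.of_nat s - Z.of_nat m in 2 * (Z.of_nat r * k) + 7 * (k * (k - 1)))%Z.
Proof.
move=> r7 /=; have H k : (2 * 'C(k, 2) + k = k * k)%N.
  elim: k => [|k IH] //; rewrite binS bin1; lia.
rewrite /jdeg; case: (leqP m s) => Hs.
  have [k ->] : exists k, s = (m + k)%N by exists (s - m)%N; rewrite subnKC.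
  rewrite addKn; move: (H k); move: ('C(k, 2))%N => c; nia.
have [k ->] : exists k, m = (s + k)%N by exists (m - s)%N; rewrite subnKC // ltnW.
rewrite addKn; move: (H k); move: ('C(k, 2))%N => c; nia.
Qed.

Lemma gcount_le_card (G : gset) (T : finType) (P : pred (gT G)) (Q : pred T) (f : gT G -> T) n :
  (forall z, P z -> gw z = n -> Q (f z)) ->
  (forall z z', P z -> P z' -> gw z = n -> gw z' = n -> f z = f z' -> z = z') ->
  (gcount P n <= #|Q|)%N.
Proof.
move=> Hf finj; rewrite /gcount cardE -!size_filter -(size_map f); apply: uniq_leq_size.
  rewrite map_inj_in_uniq ?filter_uniq ?gfib_uniq // => z z'.
  rewrite !mem_filter !mem_gfib => /andP[Pz /eqP wz] /andP[Pz' /eqP wz'].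
  exact: finj.
move=> _ /mapP[z + ->]; rewrite mem_filter mem_gfib mem_enum => /andP[Pz /eqP wz].
exact: Hf.
Qed.

Lemma gcount_ge_seq (G : gset) (P : pred (gT G)) n (s : seq (gT G)) :
  uniq s -> all (fun z => P z && (gw z == n)) s -> (size s <= gcount P n)%N.
Proof.
move=> Us /allP Hs; rewrite /gcount -size_filter; apply: uniq_leq_size => // z /Hs.
by rewrite mem_filter mem_gfib.
Qed.

(** Write w_r = 7 k_r + r - 3; the k_r sum to 0. Then |w|^2 = 14 sum_r (r k_r + 7 k_r (k_r - 1) / 2)
    + 28, where 28 is the sum of the (r - 3)^2. This is the origin of N = n + 2. *)
Lemma ccls_le_Xser n : (ccls (14 * (n + 2)) 1 0)%:Z <= Xser n.
Proof.
set N := (14 * (n + 2))%N; pose m := (N + 2)%N.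
rewrite (@Xser_count n m); last by rewrite /m /N; lia.
rewrite lez_nat; apply: (gcount_le_card (G := G7) (f := core m)) => [w Pw Gw|w w' Pw Pw' Gw Gw' E];
  last first.
  have K r : (r < 7)%N -> wz w r = wz w' r.
    move=> r7; rewrite !wzE //.
    have := @coreE m w (Ordinal r7); have := @coreE m w' (Ordinal r7).
    by rewrite E Gw Gw' /m leqnn => /(_ isT) -> /(_ isT) /= /Z.add_cancel_r ->.
  move: (K 0%N isT) (K 1%N isT) (K 2%N isT) (K 3%N isT) (K 4%N isT) (K 5%N isT) (K 6%N isT).
  clear; vec7 w a b c d e f g; vec7 w' a' b' c' d' e' f' g'.
  by rewrite /wz /= => -> -> -> -> -> -> ->.
pose F r := Z.to_nat (kz w r + Z.of_nat m).
have cF (r : 'I_7) : core m w r = F r :> nat.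
  by have := @coreE m w r; rewrite Gw /m leqnn => /(_ isT); rewrite /F; lia.
have FE r : (r < 7)%N -> Z.of_nat (F r) = (kz w r + Z.of_nat m)%Z.
  move=> r7; have := @coreE m w (Ordinal r7); rewrite Gw /m leqnn => /(_ isT).
  by rewrite cF.
have JE r : (r < 7)%N -> (2 * Z.of_nat (jdeg m r (F r)) =
    2 * (Z.of_nat r * kz w r) + 7 * (kz w r * (kz w r - 1)))%Z.
  move=> r7; rewrite jdegE 1?ltnW // FE //.
  by have -> : (kz w r + Z.of_nat m - Z.of_nat m = kz w r)%Z by lia.
suff : (\sum_(r < 7) F r == 7 * m)%N && (\sum_(r < 7) jdeg m r (F r) == n)%N.
  move=> /andP[H1 H2]; apply/andP; split; first by under eq_bigr do rewrite cF.
  by under eq_bigr do rewrite cF.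
rewrite !big_ord_recr !big_ord0 /=.
have S1 : (wz w 0 + wz w 1 + wz w 2 + wz w 3 + wz w 4 + wz w 5 + wz w 6 = 0)%Z.
  by move: Pw; clear; vec7 w a b c d e f g; rewrite /cls /wz /=; lia.
have S2 : (wz w 0 * wz w 0 + wz w 1 * wz w 1 + wz w 2 * wz w 2 + wz w 3 * wz w 3
    + wz w 4 * wz w 4 + wz w 5 * wz w 5 + wz w 6 * wz w 6 = 14 * (Z.of_nat n + 2))%Z.
  have : (Z.of_nat (gw (g := G7) w) = 14 * (Z.of_nat n + 2))%Z by rewrite Gw /N; lia.
  by clear; vec7 w a b c d e f g; rewrite G7w.
move: S1 S2; rewrite !(wzE Pw) //.
move: (FE 0%N isT) (FE 1%N isT) (FE 2%N isT) (FE 3%N isT) (FE 4%N isT) (FE 5%N isT) (FE 6%N isT).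
move: (JE 0%N isT) (JE 1%N isT) (JE 2%N isT) (JE 3%N isT) (JE 4%N isT) (JE 5%N isT) (JE 6%N isT).
move: (jdeg m 0 _) (jdeg m 1 _) (jdeg m 2 _) (jdeg m 3 _) (jdeg m 4 _) (jdeg m 5 _) (jdeg m 6 _).
move: (F 0%N) (F 1%N) (F 2%N) (F 3%N) (F 4%N) (F 5%N) (F 6%N).
move: (kz w 0) (kz w 1) (kz w 2) (kz w 3) (kz w 4) (kz w 5) (kz w 6).
clear => k0 k1 k2 k3 k4 k5 k6 f0 f1 f2 f3 f4 f5 f6 j0 j1 j2 j3 j4 j5 j6.
clearbody m; move=> J0 J1 J2 J3 J4 J5 J6 F0 F1 F2 F3 F4 F5 F6 S1 S2.
apply/andP; split; apply/eqP.
  by clear J0 J1 J2 J3 J4 J5 J6 S2; lia.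
clear F0 F1 F2 F3 F4 F5 F6.
have Hq k c : ((7 * k + c - 3) * (7 * k + c - 3) =
  49 * (k * k) + 14 * (c * k) - 42 * k + c * c - 6 * c + 9)%Z by ring.
have Hj k : (k * (k - 1) = k * k - k)%Z by ring.
move: S1 S2; rewrite !Hq; move: J0 J1 J2 J3 J4 J5 J6; rewrite !Hj {Hq Hj}.
move: (k0 * k0)%Z (k1 * k1)%Z (k2 * k2)%Z (k3 * k3)%Z (k4 * k4)%Z (k5 * k5)%Z (k6 * k6)%Z.
move=> q0 q1 q2 q3 q4 q5 q6 J0 J1 J2 J3 J4 J5 J6 S1 S2.
apply: Nat2Z.inj; rewrite !Nat2Z.inj_add; apply: (Z.mul_reg_l _ _ 2) => //.
rewrite !Z.mul_add_distr_l J0 J1 J2 J3 J4 J5 J6; clear J0 J1 J2 J3 J4 J5 J6.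
move: (Z.of_nat n) S1 S2; clear => n.
change (Z.of_nat 0) with 0%Z; change (Z.of_nat 1) with 1%Z; change (Z.of_nat 2) with 2%Z;
  change (Z.of_nat 3) with 3%Z; change (Z.of_nat 4) with 4%Z; change (Z.of_nat 5) with 5%Z;
  change (Z.of_nat 6) with 6%Z.
lia.
Qed.

(** The case N = 4: the right-hand coefficient is 3 and q^2 contributes 1, so two vectors
    suffice. *)
Lemma ccls_56 : (2 <= ccls 56 1 0)%N.
Proof.
pose w1 : vec7 := (4, (-2, (-1, (0, (1, (-5, 3))))))%Z.
pose w2 : vec7 := (-3, (5, (-1, (0, (1, (2, -4))))))%Z.
exact: (@gcount_ge_seq G7 (cls 1 0) 56 [:: w1; w2]).
Qed.

(** * Triangular numbers indexed by naturals and by integers, and the conclusion *)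

Definition tri_of_nat (k : nat) : Z :=
  if (k %% 2 == 0)%N then Z.of_nat (k %/ 2) else (- Z.of_nat (k %/ 2) - 1)%Z.
Definition nat_of_tri (z : Z) : nat := Z.to_nat (if (0 <=? z)%Z then 2 * z else - (2 * z) - 1)%Z.

Lemma tri_of_natK : cancel tri_of_nat nat_of_tri.
Proof. by move=> k; rewrite /tri_of_nat /nat_of_tri; do 2?case: ifP; lia. Qed.
Lemma nat_of_triK : cancel nat_of_tri tri_of_nat.
Proof. by move=> z; rewrite /tri_of_nat /nat_of_tri; do 2?case: ifP; lia. Qed.

(** The order 0, -1, 1, -2, 2, ... of the integers runs through the triangular numbers
    increasingly. *)
Lemma wtri_of_nat k : wtri (tri_of_nat k) = (k * k.+1 %/ 2)%N.
Proof.
apply: Nat2Z.inj; rewrite wtriE /tri_of_nat; case: ifP => Hk.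
  have [a ->] : exists a, k = (2 * a)%N by exists (k %/ 2)%N; lia.
  by rewrite -mulnA !mulKn //; lia.
have [a ->] : exists a, k = (2 * a + 1)%N by exists (k %/ 2)%N; lia.
have -> : ((2 * a + 1) * (2 * a + 1).+1 = 2 * ((2 * a + 1) * (a + 1)))%N by lia.
have -> : ((2 * a + 1) %/ 2 = a)%N by lia.
by rewrite mulKn //; lia.
Qed.

Lemma Series_qpsi : Series qpsi = psi.
Proof.
apply: seriesP => n; rewrite gsE /= /qpsi /fps_Xn.
under eq_bigr do rewrite eq_sym.
transitivity (size [seq k <- iota 0 n.+1 | (k * k.+1 %/ 2 == n)%N])%:Z.
  rewrite size_filter -sum1_count /index_iota subn0 (big_morph Posz PoszD (erefl _)) /=.
  by rewrite [RHS]big_mkcond; apply: eq_bigr => k _; case: eqP.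
have Hs k : (k \in [seq k <- iota 0 n.+1 | (k * k.+1 %/ 2 == n)%N]) = (wtri (tri_of_nat k) == n).
  rewrite mem_filter mem_iota wtri_of_nat add0n /=; case: eqP => //= <-.
  by rewrite ltnS leq_divRL // leq_mul2l; case: k.
congr Posz; apply/eqP; rewrite eqn_leq; apply/andP; split.
  rewrite -(size_map tri_of_nat); apply: gcount_ge_seq.
    by rewrite map_inj_uniq ?filter_uniq ?iota_uniq //; exact: can_inj tri_of_natK.
  by apply/allP => _ /mapP[k + ->]; rewrite Hs.
rewrite /gcount count_predT -(size_map nat_of_tri); apply: uniq_leq_size.
  rewrite map_inj_uniq; first exact: gfib_uniq.
  by move=> z z' /(congr1 tri_of_nat); rewrite !nat_of_triK.
move=> _ /mapP[z Hz ->]; rewrite Hs nat_of_triK.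
by have <- : (z \in gfib gtri n) = (wtri z == n) by exact: mem_gfib.
Qed.

Definition rhs : series := psi ^+ 3 * dil 6 psi ^+ 3.

Lemma rhs_series :
  Series (fps_mul (fps_Xn 1) (fps_mul (fps_exp qpsi 3) (fps_exp (fps_dilate 7 qpsi) 3))) = sX * rhs.
Proof.
rewrite /rhs -Series_qpsi -fps_dilate_series -!fps_exp_series; exact: seriesP.
Qed.

Lemma b3_rhs n : b3 (n.+2)%N = (sX * rhs) n.
Proof.
have -> : b3 = sX * (sX * (sX * rhs)) by rewrite /b3 /psi7 /rhs; ring.
by rewrite !sXM_S.
Qed.

Lemma b3_4 : b3 4 = 3.
Proof.
have M0 (f g : series) : (f * g) 0%N = f 0%N * g 0%N by rewrite cfM big_ord1.
have M1 (f g : series) : (f * g) 1%N = f 0%N * g 1%N + f 1%N * g 0%N.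
  by rewrite cfM big_ord_recl big_ord1.
have p0 : psi 0%N = 1 by rewrite -Series_qpsi /= /qpsi big_nat1.
have p1 : psi 1%N = 1 by rewrite -Series_qpsi /= /qpsi big_nat_recr //= big_nat1.
have d0 : dil 6 psi 0%N = 1 by rewrite -(muln0 7) dilE.
have d1 : dil 6 psi 1%N = 0 by rewrite dil_ndvd.
by rewrite b3_rhs sXM_S /rhs !exprS !expr0 !mulr1 !(M0, M1) p0 p1 d0 d1.
Qed.

Theorem theorem1p2 (n : nat) :
  coef n (fps_add (fps_div (fps_exp (fps_dilate 7 qE) 7) qE) (fps_Xn 2))
  >= coef n (fps_mul (fps_Xn 1)
               (fps_mul (fps_exp qpsi 3) (fps_exp (fps_dilate 7 qpsi) 3))).
Proof.
change (Xser n + fps_Xn 2 n >= Series (fps_mul (fps_Xn 1)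
  (fps_mul (fps_exp qpsi 3) (fps_exp (fps_dilate 7 qpsi) 3))) n).
rewrite rhs_series -b3_rhs; have HX := ccls_le_Xser n.
have [En|n2] := eqVneq n 2%N.
  move: HX; rewrite En b3_4 /fps_Xn eqxx => HX; have := ccls_56.
  by rewrite -lez_nat => /le_trans/(_ HX); lia.
have H0 : (0 : int) <= fps_Xn 2 n by rewrite /fps_Xn; case: (n == 2%N).
have Hy : b3 (n.+2)%N *+ 56 <= Ys (n.+2)%N by apply: Ys_ge; lia.
have := Ys_le_clam (n.+2)%N; have := @cconst_le (n.+2)%N isT; rewrite clam_sum.
move: HX Hy; rewrite addn2 -mulr_natr; move: (ccls _ 1 0) (cconst _) => c k.
move: (b3 _) (Ys _) (Xser n) (fps_Xn 2 n) H0 => b y x e H0; lia.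
Qed.
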